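(* Let $(X,\mathscr B,m)$ be an abstract probability space and let $P:L^1(m)\to L^1(m)$ be a Markov operator. Then the following conditions are equivalent: (MC) $P$ is mean constrictive; (FED) $P$ admits finitely many ergodic $P$-invariant densities $h_1,\dots,h_r$ with mutually disjoint supports (up to an $m$-null set), and the invariant density $h=\frac1r(h_1+\dots+h_r)$ has the maximal support; (APM) there exist finitely many ergodic $P$-invariant densities $h_1,\dots,h_r$ with mutually disjoint supports (up to an $m$-null set) and positive bounded linear functionals $\lambda_1,\dots,\lambda_r$ on $L^1(m)$ such that $$\lim_{n\to\infty}\Big\|A_n\varphi-\sum_{i=1}^r\lambda_i(\varphi)h_i\Big\|=0\quad\text{for any }\varphi\in L^1(m).$$
   Context: $\|\cdot\|$ is the $L^1(m)$-norm and $D(m)=\{h\in L^1(m):h\ge0\ m\text{-a.e.},\ \|h\|=1\}$. A Markov operator $P$ on $L^1(m)$ is a linear positive operator with $\int P\varphi\,dm=\int\varphi\,dm$ for all $\varphi\in L^1(m)$. $P^*$ is its adjoint on $L^\infty(m)$ and $P^{n*}=(P^n)^*=(P^* )^n$. $A_n=\frac1n\sum_{i=0}^{n-1}P^i$. $P$ is mean constrictive if there is a compact set $F\subset L^1(m)$ with $\lim_{n\to\infty}d(A_nh,F)=0$ for every $h\in D(m)$, where $d(\varphi,F)=\inf_{\psi\in F}\|\varphi-\psi\|$. $\operatorname{supp}h=\{x:h(x)\neq0\}$ (up to an $m$-null set). A $P$-invariant density is $h\in D(m)$ with $Ph=h$. It has the maximal support if $\lim_{n\to\infty}P^{n*}1_{\operatorname{supp}h}(x)=1$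 for $m$-a.e. $x$. It is ergodic if $\int_Ah\,dm\in\{0,1\}$ for every $A\in\mathscr B$ with $P^*1_A\ge1_A$ ($m$-a.e.). *)

(* Defs.v *)
From HB Require Import structures.
From mathcomp Require Import all_boot all_order all_algebra.
From mathcomp Require Import all_classical all_reals.
From mathcomp Require Import ereal topology normedtype sequences measure.
From mathcomp Require Import measurable_realfun lebesgue_measure lebesgue_integral.
From mathcomp Require Import ess_sup_inf numfun exp hoelder probability.

Set Implicit Arguments.
Unset Strict Implicit.
Unset Printing Implicit Defensive.

Import Order.TTheory GRing.Theory Num.Theory.
Import numFieldNormedType.Exports.

Local Open Scope classical_set_scope.
Local Open Scope ring_scope.
Local Open Scope quotient_scope.

(* The library's [LspaceType mu p1] is the set of classes, modulo equality
   mu-a.e., of functions with finite p-norm; a class is used as a function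
   through its canonical representative [repr]. It carries no algebraic
   structure in the library: this section makes it a normed module over R. *)
Section LspaceQuotient.
Context d (T : measurableType d) (R : realType).
Variables (mu : {measure set T -> \bar R}) (p : \bar R) (p1 : (1 <= p)%E).

Notation ty := (LspaceType mu p1).
Notation Lf := (LfunType mu p1).

Lemma ae_eq_Lnorm (f g : T -> R) : measurable_fun setT f ->
  measurable_fun setT g -> f = g %[ae mu] ->
  'N[mu]_p[EFin \o f]%E = 'N[mu]_p[EFin \o g]%E.
Proof.
move=> mf mg fg; rewrite unlock.
case: p p1 => [r _|_|]; last by [].
- suff -> : (\int[mu]_x `|(EFin \o f) x| `^ r =
    \int[mu]_x `|(EFin \o g) x| `^ r)%E by [].
  apply: ge0_ae_eq_integral.
  + by [].
  + apply: (measurableT_comp (measurable_poweR _)).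
    by apply: measurableT_comp => //; exact/measurable_EFinP.
  + apply: (measurableT_comp (measurable_poweR _)).
    by apply: measurableT_comp => //; exact/measurable_EFinP.
  + by move=> x _; exact: poweR_ge0.
  + by move=> x _; exact: poweR_ge0.
  + by move: fg; apply: filterS => x /[apply] /= ->.
- case: ifPn => // _; apply: eq_ess_sup.
  by move: fg; apply: filterS => x /= ->.
Qed.

Definition Lspace_fun (f : ty) : T -> R := f.

Lemma measurable_Lspace_fun (f : ty) : measurable_fun setT (Lspace_fun f).
Proof.
exact: (measurable_funPT (repr (f : {mfun_ mu, T >-> measurableTypeR R}))).
Qed.

Lemma Lspace_fun_Lfun (f : ty) : Lspace_fun f \in Lfun mu p.
Proof.
rewrite !inE; apply/andP; split; rewrite inE.
  exact: measurable_Lspace_fun.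
exact: Lebesgue_finite.
Qed.

Definition Lfun_of_Lspace (f : ty) : Lf := Lfun_Sub p1 (Lspace_fun_Lfun f).

Definition mfunR (f : Lf) : {mfun T >-> measurableTypeR R} :=
  HB.pack (f : T -> measurableTypeR R)
    (isMeasurableFun.Build _ _ T (measurableTypeR R) f (measurable_funPT f)).

Definition ae_class (f : Lf) : {mfun_ mu, T >-> measurableTypeR R} :=
  \pi_({mfun_ mu, T >-> measurableTypeR R}) (mfunR f).

Lemma ae_classE (f : Lf) : (ae_class f : T -> R) = f %[ae mu].
Proof.
have /eqP := reprK (ae_class f).
by rewrite eqmodE => /asboolP.
Qed.

Lemma finite_norm_ae_class (f : Lf) : finite_norm mu p (ae_class f).
Proof.
rewrite /finite_norm (@ae_eq_Lnorm _ f).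
- exact: Lfunction_finite.
- exact: (measurable_funPT (repr (ae_class f))).
- exact: measurable_funPT.
- exact: ae_classE.
Qed.

Definition Lspace_of (f : Lf) : ty :=
  HB.pack (ae_class f)
    (isFinLebesgue.Build _ _ _ _ _ p1 _ (finite_norm_ae_class f)).

Lemma Lspace_ofE (f : Lf) : Lspace_fun (Lspace_of f) = f %[ae mu].
Proof. exact: ae_classE. Qed.

Lemma Lspace_eq (f g : ty) : Lspace_fun f = Lspace_fun g %[ae mu] -> f = g.
Proof.
case: f g => [f [[hf]]] [g [[hg]]] fg.
have efg : f = g.
  rewrite -[f]reprK -[g]reprK; apply/eqP; rewrite eqmodE; exact/asboolP.
by subst g; rewrite (Prop_irrelevance hf hg).
Qed.


HB.instance Definition _ := gen_eqMixin ty.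
HB.instance Definition _ := gen_choiceMixin ty.

Let zero : ty := Lspace_of 0.
Let opp (f : ty) : ty := Lspace_of (- Lfun_of_Lspace f).
Let add (f g : ty) : ty := Lspace_of (Lfun_of_Lspace f + Lfun_of_Lspace g).
Let scale (a : R) (f : ty) : ty := Lspace_of (a *: Lfun_of_Lspace f).

Let zeroE : \forall x \ae mu, Lspace_fun zero x = 0.
Proof. by have := Lspace_ofE (0 : Lf); apply: filterS => x /(_ I). Qed.

Let oppE f : \forall x \ae mu, Lspace_fun (opp f) x = - Lspace_fun f x.
Proof.
by have := Lspace_ofE (- Lfun_of_Lspace f); apply: filterS => x /(_ I).
Qed.

Let addE f g :
  \forall x \ae mu, Lspace_fun (add f g) x = Lspace_fun f x + Lspace_fun g x.
Proof.
have := Lspace_ofE (Lfun_of_Lspace f + Lfun_of_Lspace g).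
by apply: filterS => x /(_ I).
Qed.

Let scaleE a f :
  \forall x \ae mu, Lspace_fun (scale a f) x = a * Lspace_fun f x.
Proof.
by have := Lspace_ofE (a *: Lfun_of_Lspace f); apply: filterS => x /(_ I).
Qed.

Let addA : associative add.
Proof.
move=> f g h; apply: Lspace_eq; near=> x => _.
rewrite (near (addE f (add g h)) x)// (near (addE g h) x)//.
by rewrite (near (addE (add f g) h) x)// (near (addE f g) x)// addrA.
Unshelve. all: by end_near. Qed.

Let addC : commutative add.
Proof.
move=> f g; apply: Lspace_eq; near=> x => _.
by rewrite (near (addE f g) x)// (near (addE g f) x)// addrC.
Unshelve. all: by end_near. Qed.

Let add0 : left_id zero add.
Proof.
move=> f; apply: Lspace_eq; near=> x => _.
by rewrite (near (addE zero f) x)// (near zeroE x)// add0r.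
Unshelve. all: by end_near. Qed.

Let addN : left_inverse zero opp add.
Proof.
move=> f; apply: Lspace_eq; near=> x => _.
rewrite (near (addE (opp f) f) x)// (near (oppE f) x)// (near zeroE x)//.
by rewrite addNr.
Unshelve. all: by end_near. Qed.

HB.instance Definition _ := GRing.isZmodule.Build ty addA addC add0 addN.

Let scaleA a b f : scale a (scale b f) = scale (a * b) f.
Proof.
apply: Lspace_eq; near=> x => _.
rewrite (near (scaleE a (scale b f)) x)// (near (scaleE b f) x)//.
by rewrite (near (scaleE (a * b) f) x)// mulrA.
Unshelve. all: by end_near. Qed.

Let scale1 : left_id 1 scale.
Proof.
move=> f; apply: Lspace_eq; near=> x => _.
by rewrite (near (scaleE 1 f) x)// mul1r.
Unshelve. all: by end_near. Qed.

Let scaleDr : right_distributive scale +%R.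
Proof.
move=> a f g; apply: Lspace_eq; near=> x => _.
rewrite (near (scaleE a (add f g)) x)// (near (addE f g) x)//.
rewrite (near (addE (scale a f) (scale a g)) x)// (near (scaleE a f) x)//.
by rewrite (near (scaleE a g) x)// mulrDr.
Unshelve. all: by end_near. Qed.

Let scaleDl f : {morph scale^~ f : a b / a + b}.
Proof.
move=> a b; apply: Lspace_eq; near=> x => _.
rewrite (near (scaleE (a + b) f) x)//.
rewrite (near (addE (scale a f) (scale b f)) x)// (near (scaleE a f) x)//.
by rewrite (near (scaleE b f) x)// mulrDl.
Unshelve. all: by end_near. Qed.

HB.instance Definition _ :=
  GRing.Zmodule_isLmodule.Build R ty scaleA scale1 scaleDr scaleDl.

Lemma Lspace_fun0 : \forall x \ae mu, Lspace_fun (0 : ty) x = 0.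
Proof. exact: zeroE. Qed.

Lemma Lspace_funN (f : ty) :
  \forall x \ae mu, Lspace_fun (- f) x = - Lspace_fun f x.
Proof. exact: oppE. Qed.

Lemma Lspace_funD (f g : ty) :
  \forall x \ae mu, Lspace_fun (f + g) x = Lspace_fun f x + Lspace_fun g x.
Proof. exact: addE. Qed.

Lemma Lspace_funZ (a : R) (f : ty) :
  \forall x \ae mu, Lspace_fun (a *: f) x = a * Lspace_fun f x.
Proof. exact: scaleE. Qed.

Let norm (f : ty) : R := fine ('N[mu]_p[EFin \o Lspace_fun f])%E.

Let norm_of (f : Lf) : norm (Lspace_of f) = fine ('N[mu]_p[EFin \o f])%E.
Proof.
congr fine; apply: ae_eq_Lnorm (Lspace_ofE f).
  exact: measurable_Lspace_fun.
exact: (measurable_funPT f).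
Qed.

Let normD f g : norm (f + g) <= norm f + norm g.
Proof.
rewrite [norm (f + g)]norm_of.
exact: (ler_LnormD (Lfun_of_Lspace f) (Lfun_of_Lspace g)).
Qed.

Let normZ a f : norm (a *: f) = `|a| * norm f.
Proof.
rewrite [norm (a *: f)]norm_of.
have := LnormZ (Lfun_of_Lspace f) a.
rewrite -(finite_norm_fine (Lfun_of_Lspace f)) => e.
rewrite (_ : fine _ = fine ('N[mu]_p[EFin \o (a \*: (Lfun_of_Lspace f : T -> R))]))%E //.
by rewrite e.
Qed.

Let norm0_eq0 f : norm f = 0 -> f = 0.
Proof.
move=> /(@fine_Lnormr_eq0 _ _ _ _ _ _ (Lfun_of_Lspace f)) f0.
apply: Lspace_eq; near=> x => _.
by rewrite (near Lspace_fun0 x)//; apply: (near f0 x).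
Unshelve. all: by end_near. Qed.

HB.instance Definition _ := Lmodule_isNormed.Build R ty normD normZ norm0_eq0.

Lemma Lspace_normE (f : ty) : `|f| = fine ('N[mu]_p[EFin \o Lspace_fun f])%E.
Proof. by []. Qed.

End LspaceQuotient.

(* All statements below about the values of a class concern its representative
   and are only meant m-a.e. *)
Notation L1 m := (LspaceType m (@lexx _ _ 1%E)).
Notation Linf m := (LspaceType m (@leey _ 1%E)).

Section MarkovOperators.
Context d (X : measurableType d) (R : realType) (m : probability X R).

Lemma L1_normE (f : L1 m) : `|f| = fine (\int[m]_x `|(f x)%:E|)%E.
Proof. by rewrite Lspace_normE Lnorm1. Qed.

Lemma finite_norm_indic (A : set X) :
  finite_norm m +oo%E (\1_A : X -> R).
Proof.
rewrite /finite_norm unlock /=; case: ifPn => // _.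
rewrite (@le_lt_trans _ _ 1%E) ?ltry//; apply: ereal_inf_lbound => /=.
by apply: aeW => x /=; rewrite lee_fin indicE ger0_norm// lern1 leq_b1.
Qed.

Lemma indic_Lfun (A : set X) : measurable A ->
  (\1_A : X -> R) \in Lfun m +oo%E.
Proof.
move=> mA; rewrite !inE; apply/andP; split; rewrite inE.
  exact: measurable_indic.
exact: finite_norm_indic.
Qed.

Definition Linf_indic (A : set X) (mA : measurable A) : Linf m :=
  Lspace_of (Lfun_Sub (@leey _ 1%E) (indic_Lfun mA)).

Definition positive_operator (P : {linear L1 m -> L1 m}) : Prop :=
  forall phi : L1 m, (\forall x \ae m, 0 <= phi x) ->
    \forall x \ae m, 0 <= P phi x.

Definition markov_operator (P : {linear L1 m -> L1 m}) : Prop :=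
  positive_operator P /\
  forall phi : L1 m, (\int[m]_x (P phi x)%:E = \int[m]_x (phi x)%:E)%E.

(* The operator on Linf dual to P for the pairing of L1 with Linf. If P is
   bounded (every Markov operator is), the class k exists, the dual of L1 being
   Linf, and it is unique; the default value 0 is only for unbounded P. *)
Definition adjoint (P : {linear L1 m -> L1 m}) (g : Linf m) : Linf m :=
  xget 0 [set k : Linf m | forall phi : L1 m,
    (\int[m]_x (P phi x * g x)%:E = \int[m]_x (phi x * k x)%:E)%E].

Definition cesaro_mean (P : {linear L1 m -> L1 m}) (n : nat) (phi : L1 m) :
    L1 m :=
  n%:R^-1 *: \sum_(i < n) iter i P phi.

Definition density (h : L1 m) : Prop :=
  (\forall x \ae m, 0 <= h x) /\ `|h| = 1.

(* The infimum is taken in \bar R so that the distance to the empty set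
   is +oo, whereas the infimum in R of an empty set is 0. *)
Definition dist_set (phi : L1 m) (F : set (L1 m)) : \bar R :=
  ereal_inf [set `|phi - psi|%:E | psi in F].

Definition mean_constrictive (P : {linear L1 m -> L1 m}) : Prop :=
  exists F : set (L1 m), compact F /\
    forall h : L1 m, density h ->
      dist_set (cesaro_mean P n h) F @[n --> \oo] --> 0%E.

Definition supp (h : L1 m) : set X := [set x | h x != 0].

Lemma measurable_supp (h : L1 m) : measurable (supp h).
Proof.
rewrite (_ : supp h = Lspace_fun h @^-1` [set~ 0]); last first.
  by apply/seteqP; split => x /= /eqP.
rewrite -[_ @^-1` _]setTI; apply: measurable_Lspace_fun => //.
exact: measurableC.
Qed.

Definition disjoint_supports (r : nat) (h : 'I_r -> L1 m) : Prop :=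
  forall i j : 'I_r, i != j -> m (supp (h i) `&` supp (h j)) = 0%E.

Definition invariant_density (P : {linear L1 m -> L1 m}) (h : L1 m) : Prop :=
  density h /\ P h = h.

Definition maximal_support (P : {linear L1 m -> L1 m}) (h : L1 m) : Prop :=
  \forall x \ae m,
    iter n (adjoint P) (Linf_indic (measurable_supp h)) x @[n --> \oo] --> (1 : R).

Definition ergodic_density (P : {linear L1 m -> L1 m}) (h : L1 m) : Prop :=
  invariant_density P h /\
  forall (A : set X) (mA : measurable A),
    (\forall x \ae m, \1_A x <= adjoint P (Linf_indic mA) x) ->
    (\int[m]_(x in A) (h x)%:E = 0 \/ \int[m]_(x in A) (h x)%:E = 1)%E.

Definition positive_functional (l : {scalar L1 m}) : Prop :=
  forall phi : L1 m, (\forall x \ae m, 0 <= phi x) -> 0 <= l phi.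

Definition bounded_functional (l : {scalar L1 m}) : Prop :=
  exists C : R, forall phi : L1 m, `|l phi| <= C * `|phi|.

Definition finite_ergodic_densities (P : {linear L1 m -> L1 m}) : Prop :=
  exists (r : nat) (h : 'I_r -> L1 m),
    [/\ (0 < r)%N,
        forall i, ergodic_density P (h i),
        disjoint_supports h &
        maximal_support P (r%:R^-1 *: \sum_(i < r) h i)].

Definition asymptotically_periodic_in_mean (P : {linear L1 m -> L1 m}) : Prop :=
  exists (r : nat) (h : 'I_r -> L1 m) (lambda : 'I_r -> {scalar L1 m}),
    [/\ (0 < r)%N,
        forall i, ergodic_density P (h i),
        disjoint_supports h,
        forall i, positive_functional (lambda i) /\
                  bounded_functional (lambda i) &
        forall phi : L1 m,
          `|cesaro_mean P n phi - \sum_(i < r) lambda i phi *: h i|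
            @[n --> \oo] --> (0 : R)].

End MarkovOperators.

(* Main.v *)
Require Import Defs.
From HB Require Import structures.
From mathcomp Require Import all_boot all_order all_algebra.
From mathcomp Require Import all_classical all_reals.
From mathcomp Require Import ereal topology normedtype sequences measure.
From mathcomp Require Import lebesgue_measure lebesgue_integral hoelder.
From mathcomp Require Import probability measurable_realfun numfun charge exp.
From mathcomp Require Import ring lra.

Set Implicit Arguments.
Unset Strict Implicit.
Unset Printing Implicit Defensive.

Import Order.TTheory GRing.Theory Num.Theory.
Import numFieldNormedType.Exports.

Local Open Scope classical_set_scope.
Local Open Scope ring_scope.

(** Write [A_n] for the averages and call a set [A] absorbing when [P] maps
    functions living on [A] to functions living on [A]; by duality this says
    that the indicator of [A] lies below its image under the adjoint
    ([absorbing_adjoint], which rests on the Radon-Nikodym theorem). Two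
    groups of facts carry the proof.

    Structure of invariant functions. Since [P] is positive and preserves
    integrals, positive parts of invariant functions are invariant
    ([invariant_pos]), the support of a nonnegative invariant function is
    absorbing ([supp_absorbing]), and restricting an invariant function to an
    absorbing set leaves it invariant ([invariant_resL]). Hence an ergodic
    density [h] is, up to a scalar, the only invariant function carried by its
    support ([ergodic_unique]).

    Convergence of averages. The averages of a coboundary [u - P u] tend to 0,
    so the averages of [f] converge to an invariant function as soon as [f]
    belongs to the closure of the coboundaries plus the invariant functions
    ([mean_ergodic]). One norm cluster point of the averages implies this
    ([cesaro_cluster_decomposable]), and so does a bound [|f| <= c h] with [h]
    invariant: there [P] is a contraction of the Hilbert space L^2 of the
    measure with density [h], and the least-norm argument of F. Riesz applies
    ([dominated_ergodic]).

    Suppose that [P] is mean constrictive, with compact set [F]. All averages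
    of densities have cluster points, hence converge, and all invariant
    densities lie in [F]. Disjointly supported densities are at distance 2 from
    each other, so only finitely many fit into [F]. A family of maximal size
    consists of ergodic densities, because an absorbing set would split a
    non-ergodic one, and the limit of [A_n 1] lives on the union [S] of the
    supports. The mass of [P^n 1] outside [S] is nonincreasing and its averages
    tend to 0, so it tends to 0, which is maximality of the support in
    integrated form ([constrictive_ergodic_densities]).

    Suppose that finitely many ergodic densities are given whose supports have
    a union [S] that is maximal. Then the part of [P^k f] outside [S] tends to
    0, and the part inside is split along the supports and approximated by
    functions dominated by the densities. So all averages converge, to
    invariant functions carried by [S], which are combinations of the
    densities; the coefficients are the required functionals
    ([ergodic_densities_periodic]).

    Finally, bounded functionals map densities to bounded coefficients, and the
    combinations of the [h i] with bounded coefficients form a compact set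
    ([periodic_constrictive]). *)

(** * Classes of integrable functions: integral, dominated convergence, completeness *)

Section L1.
Context d (X : measurableType d) (R : realType) (m : probability X R).
Notation V := (L1 m).
Implicit Types f g h phi psi : V.

(** Turns almost everywhere facts into premises at a point, one at a time, so
    that any number of them can be combined. *)
Lemma ae_mp (A B : X -> Prop) : (\forall x \ae m, A x) ->
  (\forall x \ae m, A x -> B x) -> \forall x \ae m, B x.
Proof. by move=> HA HB; apply: filterS2 HA HB => x a; apply. Qed.

Lemma L1_addE f g : \forall x \ae m, (f + g) x = f x + g x.
Proof. exact: Lspace_funD. Qed.

Lemma L1_scaleE (a : R) f : \forall x \ae m, (a *: f) x = a * f x.
Proof. exact: Lspace_funZ. Qed.

Lemma L1_subE f g : \forall x \ae m, (f - g) x = f x - g x.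
Proof.
apply: (ae_mp (L1_addE f (- g))).
by apply: filterS (Lspace_funN g) => x e ->; rewrite -e.
Qed.

Lemma L1_0E : \forall x \ae m, (0 : V) x = 0.
Proof. exact: Lspace_fun0. Qed.

Lemma L1_sumE (I : Type) (s : seq I) (F : I -> V) :
  \forall x \ae m, (\sum_(i <- s) F i) x = \sum_(i <- s) F i x.
Proof.
elim: s => [|i s IH].
  rewrite big_nil; apply: (ae_mp L1_0E); apply: aeW => x e.
  by rewrite big_nil.
rewrite big_cons; apply: (ae_mp (L1_addE (F i) (\sum_(j <- s) F j))).
apply: (ae_mp IH); apply: aeW => x e e'.
by rewrite big_cons e' e.
Qed.

Lemma L1_integrable f : m.-integrable setT (EFin \o f).
Proof. exact/Lfun1_integrable/Lspace_fun_Lfun. Qed.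

Lemma L1_measurable f : measurable_fun setT f.
Proof. exact: measurable_Lspace_fun. Qed.

Lemma L1_eq f g : (\forall x \ae m, f x = g x) -> f = g.
Proof. by move=> H; apply: Lspace_eq; apply: filterS H. Qed.

(** The default class 0 makes the construction total, so that terms carry no
    proof of integrability. *)
Definition toL1 (f : X -> R) : V :=
  if pselect (f \in Lfun m 1) is left H
  then Lspace_of (Lfun_Sub (@lexx _ _ 1%E) H) else 0.

Lemma toL1E (f : X -> R) : m.-integrable setT (EFin \o f) ->
  \forall x \ae m, toL1 f x = f x.
Proof.
move/Lfun1_integrable => H; rewrite /toL1; case: pselect => // H'.
by apply: filterS (Lspace_ofE (Lfun_Sub (@lexx _ _ 1%E) H')) => x /(_ I).
Qed.

Lemma ae_le_integrable (f : X -> R) (g : X -> \bar R) :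
  measurable_fun setT f -> m.-integrable setT g ->
  (\forall x \ae m, `|f x|%:E <= g x)%E -> m.-integrable setT (EFin \o f).
Proof.
move=> mf ig fg; apply/integrableP; split; first exact/measurable_EFinP.
case/integrableP: (ig) => mg; apply: le_lt_trans.
apply: ae_ge0_le_integral => //.
- by apply/measurable_EFinP; exact: measurableT_comp.
- exact: measurableT_comp.
- by apply: filterS fg => x H _ /=; apply: le_trans H _; exact: lee_abs.
Qed.

Definition mass f : R := \int[m]_x f x.

Lemma massE f : (mass f)%:E = (\int[m]_x (f x)%:E)%E.
Proof. by rewrite fineK//; apply: integrable_fin_num;
  last exact: L1_integrable. Qed.

Lemma mass_eq f g : (\forall x \ae m, f x = g x) -> mass f = mass g.
Proof. by move/L1_eq ->. Qed.

Lemma mass_toL1 (f : X -> R) : m.-integrable setT (EFin \o f) ->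
  (mass (toL1 f))%:E = (\int[m]_x (f x)%:E)%E.
Proof.
move=> If; rewrite massE; apply: ae_eq_integral => //.
- exact: measurable_int (L1_integrable _).
- exact: measurable_int If.
- by apply: filterS (toL1E If) => x -> _.
Qed.

Lemma massD f g : mass (f + g) = mass f + mass g.
Proof.
apply: EFin_inj; rewrite EFinD !massE -integralD_EFin//; try exact: L1_integrable.
apply: ae_eq_integral => //.
- exact: measurable_int (L1_integrable _).
- by apply/measurable_EFinP/measurable_funD; exact: L1_measurable.
- by apply: filterS (L1_addE f g) => x -> _.
Qed.

Lemma massZ a f : mass (a *: f) = a * mass f.
Proof.
rewrite -RintegralZl//; last exact: L1_integrable.
congr fine.
apply: ae_eq_integral => //.
- exact: measurable_int (L1_integrable _).
- by apply/measurable_EFinP/measurable_funM => //; exact: L1_measurable.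
- by apply: filterS (L1_scaleE a f) => x -> _.
Qed.

Lemma massN f : mass (- f) = - mass f.
Proof. by rewrite -scaleN1r massZ mulN1r. Qed.

Lemma massB f g : mass (f - g) = mass f - mass g.
Proof. by rewrite massD massN. Qed.

Lemma mass0 : mass 0 = 0.
Proof. by rewrite -(scale0r 0) massZ mul0r. Qed.

Definition absL f := toL1 (fun x => `|f x|).

Lemma absLE f : \forall x \ae m, absL f x = `|f x|.
Proof. by apply: toL1E; apply: integrable_norm; exact: L1_integrable. Qed.

Lemma norm_mass f : `|f| = mass (absL f).
Proof.
rewrite L1_normE; congr fine; apply: ae_eq_integral => //.
- by apply/measurable_EFinP; apply: measurableT_comp => //; exact: L1_measurable.
- exact: measurable_int (L1_integrable _).
- by apply: filterS (absLE f) => x -> _.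
Qed.

Lemma mass_ge0 f : (\forall x \ae m, 0 <= f x) -> 0 <= mass f.
Proof.
move=> f0; suff -> : mass f = `|f| by [].
by rewrite norm_mass; apply: mass_eq; apply: (ae_mp f0); apply: (ae_mp (absLE f));
  apply: aeW => x -> /ger0_norm.
Qed.

Lemma mass_le f g : (\forall x \ae m, f x <= g x) -> mass f <= mass g.
Proof.
move=> fg; rewrite -subr_ge0 -massB mass_ge0//.
by apply: (ae_mp fg); apply: filterS (L1_subE g f) => x ->; rewrite subr_ge0.
Qed.

Lemma norm_ge0_mass f : (\forall x \ae m, 0 <= f x) -> `|f| = mass f.
Proof.
move=> f0; rewrite norm_mass; apply: mass_eq.
by apply: (ae_mp f0); apply: filterS (absLE f) => x -> /ger0_norm.
Qed.

Lemma mass_eq0 f : (\forall x \ae m, 0 <= f x) -> mass f = 0 -> f = 0.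
Proof. by move=> f0; rewrite -norm_ge0_mass// => /normr0_eq0. Qed.

Lemma norm_le f g : (\forall x \ae m, `|f x| <= `|g x|) -> `|f| <= `|g|.
Proof.
move=> fg; rewrite !norm_mass; apply: mass_le; apply: (ae_mp fg).
by apply: (ae_mp (absLE f)); apply: filterS (absLE g) => x -> ->.
Qed.

Lemma mass_le_norm f : `|mass f| <= `|f|.
Proof.
rewrite norm_mass ler_norml -massN; apply/andP; split; apply: mass_le.
  apply: (ae_mp (absLE f)); apply: filterS (Lspace_funN (absL f)) => x e1 e2.
  by move: e1; rewrite /Lspace_fun => ->; rewrite e2 lerNl ler_normr lexx orbT.
by apply: filterS (absLE f) => x ->; rewrite ler_norm.
Qed.

(** The difference is nonnegative with zero integral. As Markov operators
    preserve the mass, this is what turns inequalities such as [P f <= f] into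
    equalities. *)
Lemma le_mass_eq f g : (\forall x \ae m, f x <= g x) -> mass f = mass g -> f = g.
Proof.
move=> fg e; apply/eqP; rewrite eq_sym -subr_eq0; apply/eqP/mass_eq0.
  by apply: (ae_mp fg); apply: filterS (L1_subE g f) => x ->; rewrite subr_ge0.
by rewrite massB e subrr.
Qed.

(** The bound [G] is extended-valued because it will be the sum of a series of
    absolute values, finite only almost everywhere. *)
Lemma L1_dominated_cvg_fun (u : V^nat) (f : X -> R) (G : X -> \bar R) :
  measurable_fun setT f -> m.-integrable setT G ->
  (\forall x \ae m, u n x @[n --> \oo] --> f x) ->
  (\forall x \ae m, forall n, (`|u n x|%:E <= G x)%E) ->
  m.-integrable setT (EFin \o f) /\ u n @[n --> \oo] --> toL1 f.
Proof.
move=> mf iG uf uG.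
have [If c0 _] : [/\ m.-integrable setT (EFin \o f),
   [sequence \int[m]_x `|(u n x)%:E - (f x)%:E|]_n @ \oo --> 0 &
   [sequence \int[m]_x (u n x)%:E]_n @ \oo --> \int[m]_x (f x)%:E]%E.
  apply: (dominated_convergence _ _ _ _ iG) => //.
  - by move=> n; exact: measurable_int (L1_integrable _).
  - exact/measurable_EFinP.
  - by apply: filterS uf => x H _; apply: cvg_EFin => //; exact: nearW.
  - by apply: filterS uG => x H n _; exact: H.
split => //; apply/subr_cvg0/norm_cvg0P.
rewrite (_ : (fun n => _) = fine \o [sequence \int[m]_x `|(u n x)%:E - (f
  x)%:E|]_n%E).
  exact: fine_cvg.
apply/funext => n /=; rewrite L1_normE; congr fine; apply: ae_eq_integral => //.
- apply/measurable_EFinP/measurableT_comp => //; exact: L1_measurable.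
- apply/measurable_EFinP/measurableT_comp => //; apply: measurable_funB => //.
  exact: L1_measurable.
- apply: (ae_mp (toL1E If)); apply: filterS (L1_subE (u n) (toL1 f)) => x e1 e2 _.
  by rewrite /= e1 e2.
Qed.

Lemma L1_dominated_cvg (u : V^nat) f g :
  (\forall x \ae m, u n x @[n --> \oo] --> f x) ->
  (forall n, \forall x \ae m, `|u n x| <= g x) ->
  u n @[n --> \oo] --> f.
Proof.
move=> uf ug; have -> : f = toL1 f.
  by apply: L1_eq; apply: filterS (toL1E (L1_integrable f)) => x ->.
have := @L1_dominated_cvg_fun u f (EFin \o g) (L1_measurable f) (L1_integrable
  g) uf.
case=> //; apply: ae_foralln => n; by apply: filterS (ug n) => x; rewrite lee_fin.
Qed.

Lemma norm_subE f g : (`|f - g|%:E = \int[m]_x `|f x - g x|%:E)%E.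
Proof.
rewrite norm_mass massE; apply: ae_eq_integral => //.
- exact: measurable_int (L1_integrable _).
- apply/measurable_EFinP/measurableT_comp => //.
  by apply: measurable_funB; exact: L1_measurable.
- by apply: (ae_mp (absLE (f - g))); apply: filterS (L1_subE f g) => x -> -> _.
Qed.

(** Riesz-Fischer: the series of the [|y (k+1) - y k|] has integral at most 2,
    hence is finite almost everywhere. At such points [y] converges, and it is
    dominated by [|y 0|] plus the sum of the series. *)
Lemma L1_summable_cvg (y : V^nat) : (forall k, `|y k.+1 - y k| <= (2^-1) ^+ k) ->
  exists l : V, y k @[k --> \oo] --> l.
Proof.
move=> hy.
pose D k x := `|y k.+1 x - y k x|.
pose G := fun x => (\sum_(0 <= k <oo) (D k x)%:E)%E.
have mD k : measurable_fun setT (D k).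
  apply: measurableT_comp => //.
  by apply: measurable_funB; exact: L1_measurable.
have D0 k x : (0 <= (D k x)%:E)%E by rewrite lee_fin normr_ge0.
have mG : measurable_fun setT G.
  by apply: ge0_emeasurable_sum => // k _; exact/measurable_EFinP.
have G0 x : (0 <= G x)%E by apply: nneseries_ge0.
have iG : m.-integrable setT G.
  apply/integrableP; split => //.
  under eq_integral => x _ do rewrite gee0_abs//.
  rewrite integral_nneseries//; last by move=> k; exact/measurable_EFinP.
  apply: (@le_lt_trans _ _ 2%:E); last exact: ltry.
  apply: lime_le.
    by apply: is_cvg_nneseries => k _ _; exact: integral_ge0.
  apply: nearW => n; apply: (@le_trans _ _ (\sum_(0 <= k < n) ((2^-1) ^+ k :
    R)%:E)%E).
    by apply: lee_sum => k _; rewrite -norm_subE lee_fin.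
  rewrite sumEFin lee_fin.
  have -> : \sum_(0 <= k < n) (2^-1 : R) ^+ k = 2 - 2 * 2^-1 ^+ n.
    elim: n => [|n IH]; first by rewrite big_geq// expr0; ring.
    by rewrite big_nat_recr//= IH exprS; field.
  by rewrite gerBl mulr_ge0// exprn_ge0.
(* The upper limit is measurable and equals the limit where the latter exists.
   *)
pose f x := fine (limn_esup (fun n => (y n x)%:E)).
have Gfin : \forall x \ae m, G x \is a fin_num.
  by apply: filterS (integrable_ae measurableT iG) => x; apply.
have yG x n : (`|y n x|%:E <= `|y 0 x|%:E + G x)%E.
  apply: (@le_trans _ _ (`|y 0 x|%:E + \sum_(0 <= k < n) (D k x)%:E)%E).
    rewrite sumEFin -EFinD lee_fin; elim: n => [|n IH].
      by rewrite big_geq// addr0.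
    rewrite big_nat_recr//= addrA -(subrK (y n x) (y n.+1 x)) addrC.
    by apply: le_trans (ler_normD _ _) _; rewrite lerD.
  by rewrite leeD2l//; exact: nneseries_lim_ge.
have [] := @L1_dominated_cvg_fun y f (fun x => (`|y 0 x|%:E + G x)%E).
- apply: measurableT_comp => //; apply: measurable_fun_limn_esup => n.
  exact/measurable_EFinP/L1_measurable.
- apply: integrableD => //; apply: integrable_norm; exact: L1_integrable.
- apply: filterS Gfin => x Gx.
  have : cvgn (fun n => y n x).
    rewrite (_ : (fun n => y n x) = (fun n => y 0 x + series (telescope (fun n
      => y n x)) n)); last first.
      by apply/funext => n; rewrite -eq_sum_telescope.
    apply: is_cvgD; first exact: is_cvg_cst.
    apply: normed_cvg; apply: nondecreasing_is_cvgn.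
      by apply: nondecreasing_series => n _ _; exact: normr_ge0.
    exists (fine (G x)) => _ [n _ <-].
    rewrite -lee_fin fineK// /series/= -sumEFin.
    exact: nneseries_lim_ge.
  move=> /[dup] yc /cvg_lim.
  suff -> : f x = limn (fun n => y n x) by [].
  rewrite /f (@cvg_limn_einf_sup _ _ (limn (fun n => y n x))%:E)//.
  by apply: cvg_EFin => //; exact: nearW.
- by apply: nearW.
by move=> _ H; exists (toL1 f).
Qed.

(** The approximate limits belonging to the tolerances [2^-k] have summable
    increments and therefore converge; [u] follows them. *)
Lemma L1_complete (u : V^nat) :
  (forall e, 0 < e -> exists a : V, \forall n \near \oo, `|u n - a| <= e) ->
  exists l : V, u n @[n --> \oo] --> l.
Proof.
move=> hu.
have e0 k : 0 < (2^-1 : R) ^+ k by rewrite exprn_gt0// invr_gt0.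
have /choice[a ha] k := hu _ (e0 k.+1).
have [k|l al] := @L1_summable_cvg a.
  have : \forall n \near \oo, `|a k.+1 - a k| <= 2^-1 ^+ k.
    near=> n.
    rewrite -[a k.+1](subrK (u n)) -addrA (le_trans (ler_normD _ _))//.
    rewrite distrC.
    apply: (@le_trans _ _ (2^-1 ^+ k.+2 + 2^-1 ^+ k.+1)).
      by apply: lerD; [near: n; exact: ha|near: n; exact: ha].
    rewrite !exprS; have := e0 k; set t := _ ^+ k => t0; lra.
  by case=> N _ /(_ N (leqnn N)).
exists l; apply/cvgrPdist_le => e e1.
have [k ke] : exists k, (2^-1 : R) ^+ k.+1 <= e / 2 /\ `|l - a k| <= e / 2.
  have : \forall k \near \oo, (2^-1 : R) ^+ k.+1 <= e / 2 /\ `|l - a k| <= e / 2.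
    near=> k; split; near: k; last first.
      by move/cvgrPdist_le : al; apply; rewrite divr_gt0.
    have := @cvg_geometric R 2^-1 2^-1; rewrite ger0_norm ?invr_ge0// => H.
    have {H} : geometric (2^-1 : R) 2^-1 k @[k --> \oo] --> (0 : R).
      by apply: H; rewrite invf_lt1// ltr1n.
    move/cvgrPdist_le => /(_ (e / 2)); rewrite divr_gt0// => /(_ isT).
    apply: filterS => k; rewrite sub0r normrN /geometric/= -exprS.
    by rewrite ger0_norm// ltW// e0.
  by case=> N _ /(_ N (leqnn N)) H; exists N.
near=> n.
rewrite -[l](subrK (a k)) -addrA (le_trans (ler_normD _ _))//.
rewrite (splitr e) lerD//; first exact: ke.2.
rewrite distrC; apply: le_trans ke.1; near: n; exact: ha.
Unshelve. all: by end_near. Qed.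
End L1.

(** * Positive parts, multiplication by weights, restriction to sets *)

Section L1Operations.
Context d (X : measurableType d) (R : realType) (m : probability X R).
Notation V := (L1 m).
Implicit Types f g phi psi : V.
Implicit Types w : X -> R.

Lemma integrable_pos_part f : m.-integrable setT (EFin \o (fun x => Num.max (f
  x) 0)).
Proof.
apply: (@ae_le_integrable _ _ _ m _ (fun x => `|f x|%:E)%E).
- by apply: measurable_maxr => //; exact: L1_measurable.
- by apply: integrable_norm; exact: L1_integrable.
- apply: aeW => x; rewrite lee_fin; case: (lerP (f x) 0) => H.
    by rewrite normr0.
  by [].
Qed.

Definition posL f : V := toL1 m (fun x => Num.max (f x) 0).

Lemma posLE f : \forall x \ae m, posL f x = Num.max (f x) 0.
Proof. exact: toL1E (integrable_pos_part f). Qed.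

Lemma posL_ge0 f : \forall x \ae m, 0 <= posL f x.
Proof. by apply: filterS (posLE f) => x ->; rewrite le_max lexx orbT. Qed.

Lemma posLB f : f = posL f - posL (- f).
Proof.
apply: L1_eq; apply: (ae_mp (posLE f)); apply: (ae_mp (posLE (- f))).
apply: (ae_mp (Lspace_funN f)); apply: filterS (L1_subE (posL f) (posL (- f))).
move=> x -> e2 -> ->; rewrite /Lspace_fun in e2; rewrite e2.
by case: (lerP (f x) 0); case: (lerP (- f x) 0); lra.
Qed.

(** The multipliers of interest are the indicators and their images under the
    adjoint operator, and all of them take values between 0 and 1. *)
Definition unit_valued (g : X -> R) :=
  measurable_fun setT g /\ \forall x \ae m, 0 <= g x <= 1.

Definition mulL (g : X -> R) f : V := toL1 m (fun x => g x * f x).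

Lemma mulLE w f : unit_valued w -> \forall x \ae m, mulL w f x = w x * f x.
Proof.
move=> [mw w01]; apply: toL1E.
apply: (@ae_le_integrable _ _ _ m _ (fun x => `|f x|%:E)%E).
- by apply: measurable_funM => //; exact: L1_measurable.
- by apply: integrable_norm; exact: L1_integrable.
- apply: filterS w01 => x /andP[w0 w1]; rewrite lee_fin normrM ger0_norm//.
  by rewrite ler_piMl.
Qed.

Lemma unit_valued_indic (A : set X) : measurable A -> unit_valued \1_A.
Proof.
move=> mA; split; first exact: measurable_indic.
by apply: aeW => x; rewrite indicE; case: (_ \in _); rewrite ?lexx ?ler01.
Qed.

Lemma unit_valued1 : unit_valued (cst 1).
Proof. by split => //; apply: aeW => x; rewrite /= lexx ler01. Qed.

Lemma mulLD w f f' : unit_valued w -> mulL w (f + f') = mulL w f + mulL w f'.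
Proof.
move=> uw; apply: L1_eq; apply: (ae_mp (mulLE (f + f') uw)).
apply: (ae_mp (mulLE f uw)); apply: (ae_mp (mulLE f' uw)).
apply: (ae_mp (L1_addE (mulL w f) (mulL w f'))); apply: filterS (L1_addE f f').
by move=> x e1 -> -> -> ->; rewrite e1 mulrDr.
Qed.

Lemma mulLZ w a f : unit_valued w -> mulL w (a *: f) = a *: mulL w f.
Proof.
move=> uw; apply: L1_eq; apply: (ae_mp (mulLE (a *: f) uw)).
apply: (ae_mp (mulLE f uw)); apply: (ae_mp (L1_scaleE a (mulL w f))).
apply: filterS (L1_scaleE a f).
by move=> x e1 -> -> ->; rewrite e1 mulrCA.
Qed.

Lemma mulL_norm w f : unit_valued w -> `|mulL w f| <= `|f|.
Proof.
move=> uw; apply: norm_le; apply: (ae_mp (mulLE f uw)).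
apply: filterS uw.2 => x /andP[w0 w1] ->.
by rewrite normrM ger0_norm// ler_piMl.
Qed.

Lemma mulL_ge0 w f : unit_valued w -> (\forall x \ae m, 0 <= f x) ->
  \forall x \ae m, 0 <= mulL w f x.
Proof.
move=> uw; apply: filterS3 uw.2 (mulLE f uw) => x /andP[w0 _] -> ?.
exact: mulr_ge0.
Qed.

Lemma mulL_le w f f' : unit_valued w -> (\forall x \ae m, f x <= f' x) ->
  \forall x \ae m, mulL w f x <= mulL w f' x.
Proof.
move=> uw ff'; apply: (ae_mp ff'); apply: (ae_mp (mulLE f uw)).
apply: filterS2 (mulLE f' uw) uw.2 => x -> /andP[w0 _] -> ?.
by rewrite ler_wpM2l.
Qed.

Definition resL (A : set X) := mulL \1_A.

Lemma resLD A f g : measurable A -> resL A (f + g) = resL A f + resL A g.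
Proof. by move=> mA; exact: (mulLD f g (unit_valued_indic mA)). Qed.

Lemma resLZ A a f : measurable A -> resL A (a *: f) = a *: resL A f.
Proof. by move=> mA; exact: (mulLZ a f (unit_valued_indic mA)). Qed.

Lemma resLB A f g : measurable A -> resL A (f - g) = resL A f - resL A g.
Proof. by move=> mA; rewrite -scaleN1r resLD// resLZ// scaleN1r. Qed.

Lemma resL0 A : measurable A -> resL A 0 = 0 :> V.
Proof. by move=> mA; rewrite -[X in resL _ X](subrr 0) resLB// subrr. Qed.

Lemma resLE A f : measurable A -> \forall x \ae m, resL A f x = \1_A x * f x.
Proof. by move=> mA; exact: (mulLE f (unit_valued_indic mA)). Qed.

Lemma resL_in A f : measurable A -> \forall x \ae m, A x -> resL A f x = f x.
Proof.
move=> mA; apply: filterS (resLE f mA) => x -> Ax.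
by rewrite indicE mem_set// mul1r.
Qed.

Lemma resL_out A f : measurable A -> \forall x \ae m, ~ A x -> resL A f x = 0.
Proof.
move=> mA; apply: filterS (resLE f mA) => x -> Ax.
by rewrite indicE memNset// mul0r.
Qed.

Lemma resLC A f : measurable A -> f = resL A f + resL (~` A) f.
Proof.
move=> mA; apply: L1_eq; apply: (ae_mp (L1_addE (resL A f) (resL (~` A) f))).
apply: (ae_mp (resLE f mA));
  apply: filterS (resLE f (measurableC mA)) => x -> -> ->.
rewrite !indicE in_setC; case: (_ \in _) => /=; ring.
Qed.

Lemma resL_id A f : measurable A -> (\forall x \ae m, ~ A x -> f x = 0) ->
  resL A f = f.
Proof.
move=> mA f0; apply: L1_eq; apply: (ae_mp f0); apply: (ae_mp (resL_in f mA)).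
apply: filterS (resL_out f mA) => x H1 H2 H3.
by have [/H2//|nA] := pselect (A x); rewrite H1// H3.
Qed.

Lemma mass_resL A f : measurable A -> (mass (resL A f))%:E = (\int[m]_(x in A)
  (f x)%:E)%E.
Proof.
move=> mA; rewrite massE [RHS]integral_mkcond; apply: ae_eq_integral => //.
- exact: measurable_int (L1_integrable _).
- apply/(measurable_restrictT _ _).1 => //.
  apply/measurable_EFinP; apply: measurable_funS (L1_measurable f) => //.
- apply: filterS (resLE f mA) => x -> _.
  by rewrite patchE indicE; case: (x \in A); rewrite ?mul1r ?mul0r.
Qed.

(** Test the hypothesis on the set where [g < f]. *)
Lemma ae_le_of_mass f g :
  (forall A, measurable A -> mass (resL A f) <= mass (resL A g)) ->
  \forall x \ae m, f x <= g x.
Proof.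
move=> H; pose A := [set x | g x < f x].
have mA : measurable A.
  have -> : A = setT `&` [set x | ((g x)%:E < (f x)%:E)%E].
    by rewrite setTI; apply/seteqP; split => x; rewrite /= lte_fin.
  by apply: measurable_lte => //; exact: measurable_int (L1_integrable _).
have fg0 : \forall x \ae m, 0 <= resL A (f - g) x.
  apply: (ae_mp (resLE (f - g) mA)).
  apply: filterS (L1_subE f g) => x e ->; rewrite e indicE.
  case: (boolP (x \in A)); rewrite ?mul0r// inE /A/= => fg.
  by rewrite mul1r subr_ge0 ltW.
have e : resL A (f - g) = 0.
  apply: (mass_eq0 fg0); apply/eqP; rewrite eq_le (mass_ge0 fg0) andbT.
  by rewrite resLB// massB subr_le0 H.
have := resL_in (f - g) mA; rewrite e => H2.
apply: (ae_mp H2); apply: (ae_mp (L1_0E m));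
  apply: filterS (L1_subE f g) => x -> ->.
by rewrite /A /= => H3; rewrite leNgt; apply/negP => /[dup] ? /H3; lra.
Qed.

Lemma toL1_unit_valued (h : X -> R) : unit_valued h -> \forall x \ae m, toL1 m
  h x = h x.
Proof.
move=> uh; apply: toL1E; apply: (@ae_le_integrable _ _ _ m _ (cst 1%E)).
- exact: uh.1.
- by have := finite_measure_integrable_cst m (1 : R); exact.
- by apply: filterS uh.2 => x /andP[h0 h1]; rewrite lee_fin ger0_norm.
Qed.

Lemma mass_toL1_indic A : measurable A -> (mass (toL1 m \1_A))%:E = m A.
Proof.
move=> mA; rewrite mass_toL1; last exact: integrable_indic.
by rewrite integral_indic// setIT.
Qed.

Lemma mass_one : mass (toL1 m (cst 1)) = 1.
Proof.
by apply: EFin_inj; rewrite -indicT mass_toL1_indic// probability_setT.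
Qed.

Lemma resL_toL1 A (k : X -> R) : measurable A -> unit_valued k ->
  resL A (toL1 m k) = mulL k (toL1 m \1_A).
Proof.
move=> mA uk; apply: L1_eq; apply: (ae_mp (toL1_unit_valued uk)).
apply: (ae_mp (toL1_unit_valued (unit_valued_indic mA))).
apply: (ae_mp (resLE (toL1 m k) mA)).
by apply: filterS (mulLE (toL1 m \1_A) uk) => x -> -> -> ->; rewrite mulrC.
Qed.

(** An adjoint is known only through its pairing with integrable functions, so
    inequalities between adjoints have to be read off from that pairing. *)
Lemma weight_le_of_mass (g k : X -> R) : unit_valued g -> unit_valued k ->
  (forall f, (\forall x \ae m, 0 <= f x) -> mass (mulL g f) <= mass (mulL k f)) ->
  \forall x \ae m, g x <= k x.
Proof.
move=> ug uk H.
have E := toL1_unit_valued.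
suff : \forall x \ae m, toL1 m g x <= toL1 m k x.
  by apply: filterS3 (E _ ug) (E _ uk) => x -> ->.
apply: ae_le_of_mass => A mA.
rewrite (resL_toL1 mA ug) (resL_toL1 mA uk); apply: H.
apply: filterS (E _ (unit_valued_indic mA)) => x ->.
by rewrite indicE.
Qed.

End L1Operations.

(** * Markov operators, absorbing sets and the mean ergodic theorem *)

Section Markov.
Context d (X : measurableType d) (R : realType) (m : probability X R).
Notation V := (L1 m).
Implicit Types f g phi psi : V.
Variables (P : {linear V -> V}) (hP : markov_operator P).

Lemma markovZ (a : R) f : P (a *: f) = a *: P f.
Proof. exact: linearZ. Qed.

Lemma markov_ge0 f : (\forall x \ae m, 0 <= f x) -> \forall x \ae m, 0 <= P f x.
Proof. exact: hP.1. Qed.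

Lemma markov_mass f : mass (P f) = mass f.
Proof. by apply: EFin_inj; rewrite !massE hP.2. Qed.

Lemma markov_le f g : (\forall x \ae m, f x <= g x) ->
  \forall x \ae m, P f x <= P g x.
Proof.
move=> fg; have : \forall x \ae m, 0 <= P (g - f) x.
  by apply: markov_ge0; apply: filterS2 fg (L1_subE g f) => x H ->;
    rewrite subr_ge0.
rewrite linearB; apply: filterS2 (L1_subE (P g) (P f)) => x -> .
by rewrite subr_ge0.
Qed.

Lemma markov_abs f : \forall x \ae m, `|P f x| <= P (absL f) x.
Proof.
have H1 : \forall x \ae m, P f x <= P (absL f) x.
  by apply: markov_le; apply: filterS (absLE f) => x ->; rewrite ler_norm.
have H2 : \forall x \ae m, P (- f) x <= P (absL f) x.
  apply: markov_le; apply: filterS2 (absLE f) (Lspace_funN f) => x -> e.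
  by rewrite /Lspace_fun in e; rewrite e -normrN ler_norm.
rewrite linearN in H2; apply: (ae_mp (Lspace_funN (P f))).
apply: filterS2 H1 H2 => x a b e; rewrite /Lspace_fun in e.
by rewrite ler_norml a andbT lerNl -e.
Qed.

Lemma markov_norm f : `|P f| <= `|f|.
Proof.
rewrite !norm_mass -(markov_mass (absL f)); apply: mass_le.
by apply: filterS2 (markov_abs f) (absLE (P f)) => x + ->.
Qed.

(** [P f^+] lies above [P f = f] and above 0, hence above [f^+], and has the
    same mass. So the invariant functions form a lattice. *)
Lemma invariant_pos f : P f = f -> P (posL f) = posL f.
Proof.
move=> e; apply/esym/le_mass_eq; last by rewrite markov_mass.
have H1 : \forall x \ae m, P f x <= P (posL f) x.
  by apply: markov_le; apply: filterS (posLE f) => x ->; rewrite le_max lexx.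
rewrite e in H1; have H2 := markov_ge0 (posL_ge0 f).
by apply: filterS3 H1 H2 (posLE f) => x a b ->; rewrite ge_max a.
Qed.

(** In terms of the adjoint this says [1_A <= P^* 1_A], see
    [absorbing_adjoint]: mass that has entered [A] stays there. *)
Definition absorbing (A : set X) := forall f, (\forall x \ae m, 0 <= f x) ->
  (\forall x \ae m, ~ A x -> f x = 0) -> \forall x \ae m, ~ A x -> P f x = 0.

(** For [f >= 0], the image of [f 1_A] lives on [A] and lies below [P f = f],
    hence below [f 1_A], and it has the same mass. The general case follows by
    splitting [f] into its positive and negative parts, which are
    invariant. *)
Lemma invariant_resL A f : measurable A -> absorbing A -> P f = f ->
  P (resL A f) = resL A f.
Proof.
move=> mA hA.
have nonneg g : P g = g -> (\forall x \ae m, 0 <= g x) -> P (resL A g) = resL A g.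
  move=> e g0; apply: le_mass_eq; last by rewrite markov_mass.
  have H1 : \forall x \ae m, P (resL A g) x <= g x.
    have := @markov_le (resL A g) g; rewrite e; apply;
      apply: filterS2 g0 (resLE g mA) => x g0x ->.
    by rewrite indicE; case: (_ \in _); rewrite ?mul1r// mul0r.
  have H2 : \forall x \ae m, ~ A x -> P (resL A g) x = 0.
    by apply: hA; [exact: mulL_ge0 (unit_valued_indic _ mA) g0|exact: resL_out].
  apply: (ae_mp (resL_in g mA));
    apply: filterS3 H1 H2 (resL_out g mA) => x a b c c'.
  by have [Ax|nA] := pselect (A x); [rewrite c'|rewrite c// b].
move=> e; have e1 := invariant_pos e.
have e2 : P (posL (- f)) = posL (- f) by apply: invariant_pos; rewrite linearN e.
have f1 := nonneg _ e1 (posL_ge0 f); have f2 := nonneg _ e2 (posL_ge0 (- f)).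
by rewrite [f]posLB resLB// linearB f1 f2.
Qed.

Lemma iter_linear n a f g : iter n P (a *: f + g) = a *: iter n P f + iter n P g.
Proof. by elim: n => //= n ->; rewrite linearP. Qed.

Lemma iterB n f g : iter n P (f - g) = iter n P f - iter n P g.
Proof. by elim: n => //= n ->; rewrite linearB. Qed.

Lemma iter_ge0 n f : (\forall x \ae m, 0 <= f x) -> \forall x \ae m, 0 <= iter
  n P f x.
Proof. by move=> f0; elim: n => //= n IH; exact: markov_ge0. Qed.

Lemma iter_mass n f : mass (iter n P f) = mass f.
Proof. by elim: n => //= n <-; exact: markov_mass. Qed.

Lemma iter_norm n f : `|iter n P f| <= `|f|.
Proof. by elim: n => //= n; apply: le_trans; exact: markov_norm. Qed.

Lemma iter_abs n f : \forall x \ae m, `|iter n P f x| <= iter n P (absL f) x.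
Proof.
elim: n => [|n IH] /=; first by apply: filterS (absLE f) => x ->.
have H : \forall x \ae m, P (absL (iter n P f)) x <= P (iter n P (absL f)) x.
  by apply: markov_le; apply: filterS2 IH (absLE (iter n P f)) => x + ->.
by apply: filterS2 H (markov_abs (iter n P f)) => x b a; exact: le_trans a b.
Qed.

Lemma iter_invariant n f : P f = f -> iter n P f = f.
Proof. by move=> e; elim: n => //= n ->. Qed.

Notation A_ := (cesaro_mean P).

Lemma cesaroE n f : A_ n f = (n%:R^-1 : R) *: \sum_(i < n) iter i P f.
Proof. by []. Qed.

Lemma cesaro_linear n a f g : A_ n (a *: f + g) = a *: A_ n f + A_ n g.
Proof.
rewrite !cesaroE scalerA mulrC -scalerA -scalerDr; congr (_ *: _).
rewrite scaler_sumr -big_split; apply: eq_bigr => i _; exact: iter_linear.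
Qed.

Lemma cesaroB n f g : A_ n (f - g) = A_ n f - A_ n g.
Proof. by rewrite addrC -scaleN1r cesaro_linear scaleN1r addrC. Qed.

Lemma cesaro_norm n f : `|A_ n f| <= `|f|.
Proof.
rewrite cesaroE normrZ ger0_norm ?invr_ge0//.
apply: (@le_trans _ _ (n%:R^-1 * (n%:R * `|f|))).
  rewrite ler_wpM2l ?invr_ge0// (le_trans (ler_norm_sum _ _ _))//.
  apply: (@le_trans _ _ (\sum_(i < n) `|f|)); last first.
    by rewrite sumr_const card_ord mulr_natl.
  by apply: ler_sum => i _; exact: iter_norm.
by case: n => [|n]; rewrite ?invr0 ?mul0r// mulKf.
Qed.

Lemma cesaro_ge0 n f : (\forall x \ae m, 0 <= f x) -> \forall x \ae m, 0 <= A_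
  n f x.
Proof.
move=> f0.
have H : \forall x \ae m, forall i, 0 <= iter i P f x.
  by apply: ae_foralln => i; exact: iter_ge0.
apply: (ae_mp H); apply: filterS2 (L1_scaleE n%:R^-1 (\sum_(i < n) iter i P f))
  (L1_sumE (index_enum 'I_n) (fun i : 'I_n => iter i P f)) => x -> -> K.
by rewrite mulr_ge0 ?invr_ge0// sumr_ge0.
Qed.

Lemma cesaro_invariant n f : (0 < n)%N -> P f = f -> A_ n f = f.
Proof.
case: n => // n _ e; rewrite cesaroE.
under eq_bigr do rewrite iter_invariant//.
by rewrite sumr_const card_ord -[f *+ _]scaler_nat scalerA mulVf// scale1r.
Qed.

Lemma cesaro_coboundary n f : A_ n (f - P f) = n%:R^-1 *: (f - iter n P f).
Proof.
rewrite cesaroE; congr (_ *: _).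
elim: n => [|n IH]; first by rewrite big_ord0 /= subrr.
by rewrite big_ord_recr /= IH iterB -iterSr addrA subrK.
Qed.

(** Each [f - P^i f] telescopes into a coboundary [u - P u], and [f - A_n f]
    is the average of these. *)
Lemma sub_cesaro_coboundary n f : (0 < n)%N -> exists u, f - A_ n f = u - P u.
Proof.
case: n => // n _.
have H i : exists u, f - iter i P f = u - P u.
  elim: i => [|i [u e]]; first by exists 0; rewrite linear0 /= !subrr.
  exists (u + iter i P f); rewrite /= linearD opprD addrACA -e.
  by rewrite addrA subrK.
have /choice[u hu] := H.
pose c : R := n.+1%:R^-1; exists (c *: \sum_(i < n.+1) u i).
rewrite markovZ -scalerBr linear_sum -sumrB cesaroE.
under [in RHS]eq_bigr do rewrite -hu.
rewrite sumrB scalerBr sumr_const card_ord -[f *+ _]scaler_nat scalerA mulVf//.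
by rewrite scale1r.
Qed.

Lemma cvg_invn : (n%:R^-1 : R) @[n --> \oo] --> 0.
Proof. by rewrite -cvg_shiftS; exact: cvg_harmonic. Qed.

Lemma cesaro_coboundary_cvg0 f : A_ n (f - P f) @[n --> \oo] --> (0 : V).
Proof.
apply/norm_cvg0P.
have H n : `|A_ n (f - P f)| <= n%:R^-1 * (2 * `|f|).
  rewrite cesaro_coboundary normrZ ger0_norm ?invr_ge0// ler_wpM2l ?invr_ge0//.
  rewrite (le_trans (ler_normB _ _))// mulr2n mulrDl !mul1r lerD2l.
  exact: iter_norm.
apply: (@squeeze_cvgr _ _ _ _ (cst 0) (fun n => n%:R^-1 * (2 * `|f|))).
- by apply: nearW => n; rewrite normr_ge0 H.
- exact: cvg_cst.
- rewrite -[X in _ --> X](mul0r (2 * `|f|)); apply: cvgMr_tmp.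
  exact: cvg_invn.
Qed.

(** These are the functions in the closure of the sum of the coboundaries and
    the invariant functions, that is, by [mean_ergodic], functions whose
    averages converge. *)
Definition ergodic_decomposable f := forall e, 0 < e ->
  exists u g, P g = g /\ `|f - (u - P u) - g| <= e.

Lemma cesaro_markov n f : A_ n (P f) = P (A_ n f).
Proof.
have e : \sum_(i < n) iter i P (P f) = P (\sum_(i < n) iter i P f).
  by rewrite linear_sum; apply: eq_bigr => i _; rewrite -iterSr.
by rewrite cesaroE e -markovZ -cesaroE.
Qed.

(** [P] displaces [A_n f] by [A_n (f - P f)], which tends to 0. *)
Lemma cesaro_cluster_invariant f g :
  (forall e N, 0 < e -> exists n, (N <= n)%N /\ `|A_ n f - g| <= e) ->
  P g = g.
Proof.
move=> hg; apply/eqP; rewrite -subr_eq0 -normr_le0; apply/ler_addgt0Pr => e e0.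
rewrite add0r.
have e3 : 0 < e / 3 by rewrite divr_gt0.
have [N _ HN] : \forall n \near \oo, `|A_ n (f - P f)| <= e / 3.
  by have /cvgr0_norm_le := cesaro_coboundary_cvg0 f; apply.
have [n [Nn le]] := hg _ N e3.
have -> : P g - g = (A_ n f - g) - P (A_ n f - g) - A_ n (f - P f).
  rewrite cesaroB cesaro_markov linearB; apply/eqP; rewrite eq_sym subr_eq opprB.
  by rewrite addrACA [eqbRHS]addrACA [A_ n f + _]addrC.
rewrite (le_trans (ler_normB _ _))// (_ : e = e / 3 + e / 3 + e / 3); last by field.
rewrite lerD//; last exact: HN.
rewrite (le_trans (ler_normB _ _))// lerD//.
exact: le_trans (markov_norm _) le.
Qed.

(** One cluster point of the averages suffices: [f - A_n f] is a coboundary,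
    and [A_n f] is as close as desired to the invariant function [g]. *)
Lemma cesaro_cluster_decomposable f g :
  (forall e N, 0 < e -> exists n, (N <= n)%N /\ `|A_ n f - g| <= e) ->
  ergodic_decomposable f.
Proof.
move=> hg e e0; have [n [n0 le]] := hg e 1%N e0.
have [u e1] := sub_cesaro_coboundary f n0.
exists u, g; split; first exact: cesaro_cluster_invariant hg.
by rewrite -e1 subKr.
Qed.

(** [A_n] fixes the invariant part, sends the coboundary to 0 in the limit and
    does not increase the norm of the error, so the averages form a Cauchy
    sequence. *)
Lemma mean_ergodic f : ergodic_decomposable f ->
  exists g : V, P g = g /\ A_ n f @[n --> \oo] --> g.
Proof.
move=> hf.
have near_g e u g : 0 < e -> P g = g -> `|f - (u - P u) - g| <= e ->
    \forall n \near \oo, `|A_ n f - g| <= e + e.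
  move=> e0 Pg le; near=> n.
  have n0 : (0 < n)%N by near: n; exists 1%N.
  have -> : A_ n f - g = A_ n (f - (u - P u) - g) + A_ n (u - P u).
    rewrite (cesaroB n _ g) (cesaroB n f) (cesaro_invariant n0 Pg).
    by rewrite [X in _ = X + _]addrAC subrK.
  rewrite (le_trans (ler_normD _ _))// lerD//.
    by rewrite (le_trans (cesaro_norm _ _)).
  by near: n; have /cvgr0_norm_le := cesaro_coboundary_cvg0 u; apply.
have [e e0|g Ag] := @L1_complete _ _ _ m (fun n => A_ n f).
  have [u [g [Pg le]]] := hf _ (divr_gt0 e0 (ltr0n _ 2)).
  by exists g; rewrite [e]splitr; apply: near_g Pg le; rewrite divr_gt0.
exists g; split => //; apply: (@cesaro_cluster_invariant f) => e N e0.
move/cvgrPdist_le : Ag => /(_ _ e0) [M _ HM].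
exists (maxn N M); rewrite leq_maxl distrC; split => //.
by apply: HM; exact: leq_maxr.
Unshelve. all: by end_near. Qed.
End Markov.

(** * Supports of invariant functions and ergodicity *)

Section Supports.
Context d (X : measurableType d) (R : realType) (m : probability X R).
Notation V := (L1 m).
Implicit Types f g h phi psi : V.
Variables (P : {linear V -> V}) (hP : markov_operator P).

(** The approximations are the truncations of [f] between [- n h] and
    [n h]. *)
Lemma truncation_dense (f h : V) : (\forall x \ae m, 0 <= h x) ->
  (\forall x \ae m, h x = 0 -> f x = 0) ->
  forall e, 0 < e -> exists (psi : V) (c : R),
    (\forall x \ae m, `|psi x| <= c * h x) /\ `|f - psi| <= e.
Proof.
move=> h0 hf e e0.
pose t n x := Num.max (Num.min (f x) (n%:R * `|h x|)) (- (n%:R * `|h x|)).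
have tf n x : `|t n x| <= `|f x|.
  rewrite /t; have : 0 <= n%:R * `|h x| by rewrite mulr_ge0.
  set a := n%:R * _ => a0; case: (lerP (f x) a) => fa.
    case: (lerP (f x) (- a)) => fb //.
    by rewrite normrN ger0_norm// ler0_norm; lra.
  by case: (lerP a (- a)) => fb; rewrite ?normrN !ger0_norm; lra.
have th n x : `|t n x| <= n%:R * `|h x|.
  rewrite /t; have : 0 <= n%:R * `|h x| by rewrite mulr_ge0.
  set a := n%:R * _ => a0; rewrite ler_norml le_max lexx orbT /=.
  by rewrite ge_max ge_min lexx orbT /=; lra.
have tcvg x : (h x = 0 -> f x = 0) -> t n x @[n --> \oo] --> f x.
  move=> H; apply: cvg_near_cst; have [/H fx|hx] := eqVneq (h x) 0.
    by apply: nearW => n; rewrite fx; apply/eqP;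
      rewrite -normr_le0 (le_trans (tf n x))// fx normr0.
  near=> n; have : `|f x| <= n%:R * `|h x|.
    rewrite -ler_pdivrMr ?normr_gt0//; near: n; exact: nbhs_infty_ger.
  by rewrite ler_norml /t => /andP[a b]; rewrite min_l// max_l.
have mt n : measurable_fun setT (t n).
  apply: measurable_maxr.
    apply: measurable_minr; first exact: L1_measurable.
    apply: measurable_funM => //; apply: measurableT_comp => //;
      exact: L1_measurable.
  apply: measurableT_comp => //.
  apply: measurable_funM => //; apply: measurableT_comp => //; exact: L1_measurable.
have tE n : \forall x \ae m, toL1 m (t n) x = t n x.
  apply: toL1E; apply: (@ae_le_integrable _ _ _ m _ (fun x => `|f x|%:E)%E) => //.
  - by apply: integrable_norm; exact: L1_integrable.
  - by apply: aeW => x; rewrite lee_fin.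
have : (toL1 m (t n) : V) @[n --> \oo] --> f.
  apply: (@L1_dominated_cvg _ _ _ m _ f (absL f)).
    have := ae_foralln tE; apply: filterS2 hf => x H e1.
    by under eq_fun do rewrite e1; exact: tcvg.
  by move=> n; apply: filterS2 (tE n) (absLE f) => x -> ->.
move/cvgrPdist_le => /(_ _ e0)[n _ /(_ n (leqnn n)) /= Hn].
exists (toL1 m (t n)), n%:R; split => //.
by apply: filterS2 (tE n) h0 => x -> hx; rewrite (le_trans (th n x))// ger0_norm.
Unshelve. all: by end_near. Qed.

Lemma markov_dominated c f h : P h = h -> (\forall x \ae m, `|f x| <= c * h x) ->
  \forall x \ae m, `|P f x| <= c * h x.
Proof.
move=> Ph fh; have : \forall x \ae m, P (absL f) x <= P (c *: h) x.
  by apply: (markov_le hP); apply: filterS3 fh (absLE f) (L1_scaleE c h) => x H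
    -> ->.
rewrite markovZ Ph; apply: filterS3 (markov_abs hP f) (L1_scaleE c h) => x H -> H2.
exact: le_trans H H2.
Qed.

(** A bound [|psi| <= c h] is preserved by [P], so [P psi] vanishes outside
    the support of [h], and such [psi] are dense among the functions carried
    by this support. *)
Lemma supp_absorbing h : (\forall x \ae m, 0 <= h x) -> P h = h -> absorbing P
  (supp h).
Proof.
move=> h0 Ph f f0 fS.
have mS := measurable_supp h; have mSC := measurableC mS.
suff E : resL (~` supp h) (P f) = 0.
  apply: filterS2 (resL_in (P f) mSC) (L1_0E m) => x; rewrite E => H1 H2 H3.
  by rewrite -H1// H2.
apply/eqP; rewrite -normr_le0; apply/ler_addgt0Pr => e e0; rewrite add0r.
have [|psi [c [psih le]]] := truncation_dense h0 _ e0 (f := f).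
  by apply: filterS fS => x H hx; apply: H; rewrite /supp /= hx eqxx.
have E : resL (~` supp h) (P psi) = 0.
  apply: L1_eq; apply: (ae_mp (markov_dominated Ph psih)).
  apply: filterS2 (resLE (P psi) mSC) (L1_0E m) => x -> -> H.
  rewrite indicE; case: (boolP (x \in _)); rewrite ?mul0r// mul1r inE /supp /=.
  by move=> /negP; rewrite negbK => /eqP hx; move: H;
    rewrite hx mulr0 normr_le0 => /eqP.
rewrite -[resL _ _]subr0 -E -resLB// -linearB.
by rewrite (le_trans (mulL_norm _ (unit_valued_indic m mSC)))// (le_trans
  (markov_norm hP _)).
Qed.

(** Ergodicity of a density, phrased with absorbing sets; see
    [ergodic_densityE]. *)
Definition absorbing_trivial h := forall A, measurable A -> absorbing P A ->
  mass (resL A h) = 0 \/ mass (resL A h) = 1.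

(** Subtracting from [g] a multiple of [h] gives an invariant [f] of mass 0.
    The support [B] of [f^+] is absorbing, so [h] gives it mass 0 or 1. In the
    first case [f <= 0], in the second [f >= 0], and in both cases [f = 0]
    because its mass is 0. *)
Lemma ergodic_unique h g : (\forall x \ae m, 0 <= h x) -> mass h = 1 -> P h = h ->
  absorbing_trivial h -> P g = g -> (\forall x \ae m, h x = 0 -> g x = 0) ->
  g = mass g *: h.
Proof.
move=> h0 h1 Ph eh Pg gh; apply/eqP; rewrite -subr_eq0; apply/eqP.
set f := g - _.
have Pf : P f = f by rewrite /f linearB markovZ Pg Ph.
have f1 : mass f = 0 by rewrite /f massB massZ h1 mulr1 subrr.
have fh : \forall x \ae m, h x = 0 -> f x = 0.
  apply: (ae_mp gh); apply: filterS2 (L1_subE g (mass g *: h)) (L1_scaleE (mass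
    g) h).
  by move=> x -> -> H hx; rewrite H// hx mulr0 subrr.
pose B := supp (posL f).
have mB : measurable B by exact: measurable_supp.
have aB : absorbing P B.
  by apply: supp_absorbing; [exact: posL_ge0|exact: invariant_pos].
have Bf : \forall x \ae m, (B x <-> 0 < f x).
  apply: filterS (posLE f) => x; rewrite /B /supp /= => ->.
  by case: (lerP (f x) 0) => H; split => //; rewrite ?eqxx// => _; rewrite gt_eqF.
case: (eh B mB aB) => hB.
- have rB : resL B h = 0.
    by apply: mass_eq0 => //; exact: mulL_ge0 (unit_valued_indic m mB) h0.
  have fle : \forall x \ae m, f x <= (0 : V) x.
    apply: (ae_mp Bf); apply: (ae_mp fh).
    have := resL_in h mB; rewrite rB; apply: filterS2 (L1_0E m) => x -> H1 H2 H3.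
    by rewrite leNgt; apply/negP => /[dup] fx /H3/H1/esym/H2 fx0;
      rewrite fx0 ltxx in fx.
  by apply: le_mass_eq fle _; rewrite f1 mass0.
- have rB : resL B h = h.
    apply: le_mass_eq; last by rewrite hB h1.
    by apply: filterS2 h0 (resLE h mB) => x hx ->; rewrite indicE;
      case: (_ \in _); rewrite ?mul1r// mul0r.
  apply: mass_eq0 => //.
  apply: (ae_mp Bf); apply: (ae_mp fh).
  have := resL_out h mB; rewrite rB; apply: filterS => x H1 H2 H3.
  by have [/H3/ltW//|/H1/H2 ->] := pselect (B x).
Qed.
End Supports.

(** * Existence of the adjoint on weights *)

Section DualWeights.
Import HBNNSimple.
Context d (X : measurableType d) (R : realType) (m : probability X R).
Notation V := (L1 m).
Implicit Types f g h phi psi : V.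

(** By linearity [T] vanishes on simple functions, which are dense. *)
Lemma linear_indic_eq0 (T : V -> R) :
  (forall a f g, T (a *: f + g) = a * T f + T g) ->
  (forall f, `|T f| <= `|f|) ->
  (forall A, measurable A -> T (toL1 m \1_A) = 0) -> forall f, T f = 0.
Proof.
move=> lT bT iT.
have T0 : T 0 = 0.
  by apply/eqP; rewrite -normr_le0 (le_trans (bT 0))// normr0.
have TD f g : T (f + g) = T f + T g by rewrite -[f in LHS]scale1r lT mul1r.
have TZ a f : T (a *: f) = a * T f by rewrite -[X in T X]addr0 lT T0 addr0.
have TB f g : T (f - g) = T f - T g by rewrite TD -scaleN1r TZ mulN1r.
have Tsum (I : Type) (s : seq I) (F : I -> V) : T (\sum_(i <- s) F i) = \sum_(i
  <- s) T (F i).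
  by elim: s => [|i s IH]; rewrite ?big_nil ?T0// !big_cons TD IH.
have Tsimple (s : {nnsfun X >-> R}) : m.-integrable setT (EFin \o s) -> T (toL1
  m s) = 0.
  move=> si.
  pose r : seq R := finmap.enum_fset (fset_set (range s)).
  pose A i := s @^-1` [set r`_i].
  have mA i : measurable (A i) by exact: measurable_funPTI.
  have -> : toL1 m s = \sum_(i < size r) r`_i *: toL1 m \1_(A i).
    apply: L1_eq; apply: (ae_mp (toL1E si)).
    have := ae_foralln (fun i => L1_scaleE r`_i (toL1 m \1_(A i))).
    have := ae_foralln (fun i => toL1_unit_valued (unit_valued_indic m (mA i))).
    apply: filterS3 (L1_sumE (index_enum _) (fun i : 'I_(size r) =>
      r`_i *: toL1 m \1_(A i) : V)) => x -> H1 H2 ->.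
    by rewrite fimfunEord; apply: eq_bigr => i _; rewrite H2 H1.
  by rewrite Tsum big1// => i _; rewrite TZ iT ?mulr0.
have Tpos f : T (posL f) = 0.
  pose f' x := Num.max (f x) 0.
  have mf' : measurable_fun setT (EFin \o f').
    exact: measurable_int (integrable_pos_part f).
  have f'0 x : setT x -> (0 <= (EFin \o f') x)%E by rewrite lee_fin /f' le_max
    lexx orbT.
  pose s := nnsfun_approx measurableT mf'.
  have sf n x : s n x <= f' x.
    by rewrite -lee_fin /s nnsfun_approxE; exact: (le_approx n f'0).
  have si n : m.-integrable setT (EFin \o s n).
    apply: (@ae_le_integrable _ _ _ m _ (EFin \o f')) => //.
      exact: integrable_pos_part.
    by apply: aeW => x /=; rewrite lee_fin ger0_norm.
  have sc : (toL1 m (s n) : V) @[n --> \oo] --> posL f.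
    apply: (@L1_dominated_cvg _ _ _ m _ _ (posL f)).
      have := ae_foralln (fun n => toL1E (si n)).
      apply: filterS2 (posLE f) => x -> e1; under eq_fun do rewrite e1.
      exact: (fine_cvg (@cvg_nnsfun_approx _ _ _ _ measurableT _ mf' f'0 x I)).
    by move=> n; apply: filterS2 (posLE f) (toL1E (si n)) => x -> ->;
      rewrite ger0_norm// sf.
  apply/eqP; rewrite -normr_le0; apply/ler_addgt0Pr => e e0; rewrite add0r.
  move/cvgrPdist_le : sc => /(_ e e0) [n _ /(_ n (leqnn n)) H].
  by rewrite -[T _]subr0 -(Tsimple _ (si n)) -TB (le_trans (bT _)).
by move=> f; rewrite [f]posLB TB !Tpos subrr.
Qed.

(** The density is given by the Radon-Nikodym theorem. It is at most 1 because
    its integral over any set is at most the measure of that set. *)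
Lemma submeasure_density (nu : {measure set X -> \bar R}) :
  (forall A, measurable A -> (nu A <= m A)%E) ->
  exists k : X -> R, unit_valued m k /\
    forall A, measurable A -> nu A = (mass (mulL k (toL1 m \1_A)))%:E.
Proof.
move=> nu_le.
have nu_fin : (nu setT < +oo)%E.
  by apply: le_lt_trans (nu_le _ measurableT) _; rewrite probability_setT ltry.
pose nuF : {finite_measure set X -> \bar R} := mfrestr measurableT nu_fin.
have nuFE A : nuF A = nu A by rewrite /nuF /= /mfrestr /mrestr setIT.
have dom : nuF `<< m.
  apply/null_content_dominatesP => A mA mA0; apply/le_anti/andP; split => //.
  by rewrite nuFE -mA0; exact: nu_le.
have [f [f0 ffin fi fE]] := radon_nikodym_sigma_finite dom.
pose k x := fine (f x).
have kf : EFin \o k = f by apply/funext => x; rewrite /= /k fineK.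
have ki : m.-integrable setT (EFin \o k) by rewrite kf.
have kE A : measurable A -> nu A = (mass (resL A (toL1 m k)))%:E.
  move=> mA; rewrite mass_resL// -nuFE [LHS]fE//; apply: ae_eq_integral => //.
  - exact: measurable_funS (measurable_int _ fi).
  - exact: measurable_funS (measurable_int _ (L1_integrable _)).
  - by apply: filterS (toL1E ki) => x -> _; rewrite -[in LHS]kf.
have k1 : \forall x \ae m, toL1 m k x <= toL1 m (cst 1) x.
  apply: ae_le_of_mass => A mA; rewrite -lee_fin;
    rewrite -(kE A mA) (resL_toL1 mA (unit_valued1 m)).
  apply: le_trans (nu_le A mA) _.
  rewrite -mass_toL1_indic// lee_fin; apply: mass_le.
  by apply: filterS (mulLE (toL1 m \1_A) (unit_valued1 m)) => x ->; rewrite mul1r.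
have uk : unit_valued m k.
  split; first by apply/measurable_EFinP; rewrite kf; exact: measurable_int fi.
  apply: (ae_mp k1); apply: filterS2 (toL1E ki) (toL1_unit_valued (unit_valued1
    m)) => x -> -> ->.
  by rewrite andbT /k fine_ge0.
by exists k; split=> [|A mA]; [exact: uk|rewrite (kE A mA) (resL_toL1 mA uk)].
Qed.

Variables (P : {linear V -> V}) (hP : markov_operator P).

(** Positivity makes [A |-> int w P(1_A)] a measure below [m]. Its density [k]
    satisfies the duality on indicators, hence everywhere by linearity and
    continuity. *)
Lemma exists_dual_weight w : unit_valued m w -> exists k : X -> R, unit_valued
  m k /\
  forall f, mass (mulL w (P f)) = mass (mulL k f).
Proof.
move=> uw.
pose T f := mass (mulL w (P f)).
have lT a f g : T (a *: f + g) = a * T f + T g.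
  by rewrite /T linearD markovZ mulLD// mulLZ// massD massZ.
have bT f : `|T f| <= `|f|.
  by rewrite (le_trans (mass_le_norm _))// (le_trans (mulL_norm _ uw))//
    markov_norm.
have T_ge0 f : (\forall x \ae m, 0 <= f x) -> 0 <= T f.
  by move=> f0; apply: mass_ge0; apply: mulL_ge0 => //; exact: markov_ge0.
have TD f g : T (f + g) = T f + T g by rewrite -[f in LHS]scale1r lT mul1r.
have T0 : T 0 = 0.
  by apply/eqP; rewrite -normr_le0 (le_trans (bT 0))// normr0.
have TB f g : T (f - g) = T f - T g.
  by rewrite addrC -scaleN1r lT mulN1r addrC.
pose nu (A : set X) : \bar R := (T (toL1 m \1_(A : set X)))%:E.
have i0 : toL1 m \1_(set0 : set X) = 0.
  apply: L1_eq; apply: filterS2 (L1_0E m) (toL1_unit_valued (unit_valued_indic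
    m measurable0)).
  by move=> x -> ->; rewrite indic0.
have i_ge0 (A : set X) : \forall x \ae m, 0 <= toL1 m \1_A x.
  have [mA|nA] := pselect (measurable A).
    by apply: filterS (toL1_unit_valued (unit_valued_indic m mA)) => x ->.
  rewrite /toL1; case: pselect => [H|_]; last by apply: filterS (L1_0E m) => x ->.
  by apply: filterS (Lspace_ofE (Lfun_Sub (@lexx _ _ 1%E) H)) => x /(_ I) e;
    rewrite /Lspace_fun in e; rewrite e.
have nu0 : nu set0 = 0%E by rewrite /nu i0 T0.
have nu_ge0 A : (0 <= nu A)%E by rewrite lee_fin; exact: T_ge0.
have nu_add : semi_sigma_additive nu.
  move=> F mF tF mU.
  pose u n : V := \sum_(0 <= i < n) toL1 m \1_(F i).
  have Tu n : (\sum_(0 <= i < n) nu (F i))%E = (T (u n))%:E.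
    rewrite /u; elim: n => [|n IH]; first by rewrite !big_geq// T0.
    by rewrite !big_nat_recr//= IH TD EFinD.
  (* By disjointness at most one term is nonzero, namely at the index of the
     set containing x. *)
  have uE n x : \sum_(0 <= i < n) \1_(F i) x =
      (if pselect ((\bigcup_i F i) x) is left Ux then (sval (cid2 Ux) < n)%N%:R
        else 0) :> R.
    case: pselect => [Ux|nU]; last first.
      rewrite big1// => i _; rewrite indicE memNset// => Fx.
      by apply: nU; exists i.
    case: cid2 => k /= _ Fk.
    have Fi i : \1_(F i) x = (i == k)%:R :> R.
      rewrite indicE; case: eqP => [->|ik]; first by rewrite mem_set.
      by rewrite memNset// => Fx; apply: ik; apply: (tF i k) => //; exists x.
    elim: n => [|n IH]; first by rewrite big_geq.
    rewrite big_nat_recr//= IH Fi -natrD; congr (_%:R).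
    have [->|nk] := eqVneq n k; first by rewrite ltnn ltnSn.
    by rewrite addn0 ltnS [in RHS]leq_eqVlt eq_sym (negbTE nk).
  have uae n : \forall x \ae m, u n x = \sum_(0 <= i < n) \1_(F i) x.
    have := ae_foralln (fun i => toL1_unit_valued (unit_valued_indic m (mF i))).
    apply: filterS2 (L1_sumE (index_iota 0 n) (fun i => toL1 m \1_(F i))) => x -> H.
    by apply: eq_bigr => i _; rewrite H.
  have ucvg : u n @[n --> \oo] --> toL1 m \1_(\bigcup_i F i).
    apply: (@L1_dominated_cvg _ _ _ m _ _ (toL1 m (cst 1))).
      apply: filterS2 (toL1_unit_valued (unit_valued_indic m mU)) (ae_foralln
        uae) => x -> e1.
      apply: cvg_near_cst; rewrite indicE;
        case: (pselect ((\bigcup_i F i) x)) => [[k _ Fk]|nU].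
        exists k.+1 => // n /= kn; rewrite e1 uE.
        case: pselect => [Ux|[]]; last by exists k.
        case: cid2 => l /= _ Fl; rewrite mem_set; last by exists k.
        have -> : l = k by apply: (tF l k) => //; exists x.
        by rewrite kn.
      apply: nearW => n; rewrite e1 uE memNset//; case: pselect => //.
    move=> n; apply: filterS2 (uae n) (toL1_unit_valued (unit_valued1 m)) => x
      -> -> /=.
    rewrite uE; case: pselect => [Ux|_]; rewrite ?normr0//.
    by case: (_ < n)%N; rewrite ?normr1 ?normr0.
  rewrite (_ : (fun n => _) = (fun n => (T (u n))%:E)); last by apply/funext.
  apply: cvg_EFin; first exact: nearW.
  apply/cvgrPdist_le => e e0; move/cvgrPdist_le : ucvg => /(_ e e0).
  by apply: filterS => n le; rewrite -TB (le_trans (bT _)).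
pose nuM : {measure set X -> \bar R} :=
  HB.pack nu (isMeasure.Build _ _ _ nu nu0 nu_ge0 nu_add).
have nu_le A : measurable A -> (nu A <= m A)%E.
  move=> mA; rewrite -(mass_toL1_indic m mA) lee_fin.
  by rewrite (le_trans (ler_norm _))// (le_trans (bT _))// norm_ge0_mass.
have [k [uk kE]] := @submeasure_density nuM nu_le.
(* The factor 1/2 keeps the difference of the two functionals a contraction.
   *)
pose T' f := 2^-1 * (T f - mass (mulL k f)).
have lT' a f g : T' (a *: f + g) = a * T' f + T' g.
  by rewrite /T' lT (mulLD _ _ uk) (mulLZ _ _ uk) massD massZ; ring.
have bT' f : `|T' f| <= `|f|.
  rewrite /T' normrM ger0_norm ?invr_ge0// mulrC ler_pdivrMr//.
  rewrite (le_trans (ler_normB _ _))// mulr_natr mulr2n lerD//.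
  exact: le_trans (mass_le_norm _) (mulL_norm _ uk).
have iT' A : measurable A -> T' (toL1 m \1_A) = 0.
  move=> mA; have e : T (toL1 m \1_A) = mass (mulL k (toL1 m \1_A)).
    by apply: EFin_inj; exact: kE.
  by rewrite /T' e subrr mulr0.
exists k; split=> [|f]; first exact: uk.
apply/eqP; rewrite -subr_eq0.
have /eqP := linear_indic_eq0 lT' bT' iT' f.
by rewrite /T' mulf_eq0 invr_eq0 pnatr_eq0.
Qed.
End DualWeights.

(** * The adjoint operator and absorbing sets *)

Section AdjointOperator.
Context d (X : measurableType d) (R : realType) (m : probability X R).
Notation V := (L1 m).
Notation W := (Linf m).
Implicit Types f g h phi psi : V.
Variables (P : {linear V -> V}) (hP : markov_operator P).

Lemma unit_valued_Lfun (k : X -> R) : unit_valued m k -> k \in Lfun m +oo%E.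
Proof.
move=> [mk k01]; rewrite !inE; apply/andP; split; rewrite inE //.
rewrite /finite_norm unlock /=; case: ifPn => // _.
rewrite (@le_lt_trans _ _ 1%E) ?ltry//; apply: ereal_inf_lbound => /=.
by apply: filterS k01 => x /andP[k0 k1] /=; rewrite lee_fin ger0_norm.
Qed.

Lemma Linf_measurable (k : W) : measurable_fun setT k.
Proof. exact: measurable_Lspace_fun. Qed.

(** The adjoint is chosen among all classes satisfying the duality. Tested on
    indicators, the duality determines its solution almost everywhere, so the
    chosen class agrees with the weight of [exists_dual_weight]. *)
Lemma adjoint_spec (w : W) : unit_valued m w -> unit_valued m (adjoint P w) /\
  forall f, mass (mulL w (P f)) = mass (mulL (adjoint P w) f).
Proof.
move=> uw; have [k [uk kE]] := exists_dual_weight hP uw.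
have intE (v : X -> R) f : unit_valued m v ->
    (\int[m]_x (f x * v x)%:E = (mass (mulL v f))%:E)%E.
  move=> uv; rewrite massE; apply: ae_eq_integral => //.
  - apply/measurable_EFinP; apply: measurable_funM;
    [exact: L1_measurable|exact: uv.1].
  - exact: measurable_int (L1_integrable _).
  - by apply: filterS (mulLE f uv) => x -> _; rewrite mulrC.
pose K : W := Lspace_of (Lfun_Sub (@leey _ 1%E) (unit_valued_Lfun uk)).
have KE : \forall x \ae m, K x = k x.
  by apply: filterS (Lspace_ofE (Lfun_Sub (@leey _ 1%E) (unit_valued_Lfun uk)))
    => x /(_ I).
have uK : unit_valued m K.
  split; first exact: Linf_measurable.
  by apply: filterS2 KE uk.2 => x ->.
have HK : forall f, (\int[m]_x (P f x * w x)%:E = \int[m]_x (f x * K x)%:E)%E.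
  move=> f; rewrite (intE w _ uw) (intE _ _ uK) kE; congr (_%:E); apply: mass_eq.
  by apply: filterS3 (mulLE f uk) (mulLE f uK) KE => x -> -> ->.
have := xgetPex 0 (ex_intro (fun k : W => forall f,
   (\int[m]_x (P f x * w x)%:E = \int[m]_x (f x * k x)%:E)%E) K HK).
rewrite -/(adjoint P w); set k' := adjoint P w => Hk'.
have k'E : \forall x \ae m, k' x = k x.
  have : ae_eq m setT (EFin \o k) (EFin \o k').
    apply: integral_ae_eq => //.
    - apply: (@ae_le_integrable _ _ _ m _ (cst 1%E)).
      + exact: uk.1.
      + by have := finite_measure_integrable_cst m (1 : R); exact.
      + by apply: filterS uk.2 => x /andP[k0 k1]; rewrite lee_fin ger0_norm.
    - apply/measurable_EFinP; exact: Linf_measurable.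
    - move=> E _ mE; have uE := unit_valued_indic m mE.
      have H (v : X -> R) : measurable_fun setT v ->
          (\int[m]_(x in E) (v x)%:E = \int[m]_x (toL1 m \1_E x * v x)%:E)%E.
        move=> mv; rewrite integral_mkcond; apply: ae_eq_integral => //.
        + apply/(measurable_restrictT _ _).1 => //.
          by apply/measurable_EFinP; apply: measurable_funS mv.
        + apply/measurable_EFinP; apply: measurable_funM => //;
          exact: L1_measurable.
        + apply: filterS (toL1_unit_valued uE) => x -> _; rewrite patchE indicE.
          by case: (x \in E); rewrite ?mul1r ?mul0r.
      rewrite [LHS](H _ uk.1) [RHS](H _ (Linf_measurable k')) -Hk'.
      by rewrite (intE k _ uk) (intE w _ uw) kE.
  by apply: filterS => x /(_ I) /= [->].
have uk' : unit_valued m k'.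
  split; first exact: Linf_measurable.
  by apply: filterS2 k'E uk.2 => x ->.
split=> [|f]; first exact: uk'.
rewrite kE; apply: mass_eq.
by apply: filterS3 (mulLE f uk) (mulLE f uk') k'E => x -> -> ->.
Qed.

Lemma Linf_indicE A (mA : measurable A) :
  \forall x \ae m, Linf_indic m mA x = \1_A x.
Proof.
by apply: filterS (Lspace_ofE (Lfun_Sub (@leey _ 1%E) (indic_Lfun m mA))) => x
  /(_ I).
Qed.

Lemma unit_valued_Linf_indic A (mA : measurable A) : unit_valued m (Linf_indic
  m mA).
Proof.
split; first exact: Linf_measurable.
by apply: filterS2 (Linf_indicE mA) (unit_valued_indic m mA).2 => x ->.
Qed.

Lemma mulL_Linf_indic A (mA : measurable A) f : mulL (Linf_indic m mA) f = resL A f.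
Proof.
apply: L1_eq; apply: filterS3 (mulLE f (unit_valued_Linf_indic mA)) (resLE f mA)
  (Linf_indicE mA) => x -> -> -> //.
Qed.

Lemma adjoint_le (w w' : W) : unit_valued m w -> unit_valued m w' ->
  (\forall x \ae m, w x <= w' x) ->
  \forall x \ae m, adjoint P w x <= adjoint P w' x.
Proof.
move=> uw uw' ww'.
have [u1 e1] := adjoint_spec uw; have [u2 e2] := adjoint_spec uw'.
apply: (weight_le_of_mass u1 u2) => f f0; rewrite -e1 -e2; apply: mass_le.
apply: (ae_mp (markov_ge0 hP f0)).
by apply: filterS3 (mulLE (P f) uw) (mulLE (P f) uw') ww' => x -> -> ? ?;
  rewrite ler_wpM2r.
Qed.

Lemma adjoint_iter A (mA : measurable A) n :
  unit_valued m (iter n (adjoint P) (Linf_indic m mA)) /\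
  forall f, mass (resL A (iter n P f)) = mass (mulL (iter n (adjoint P)
    (Linf_indic m mA)) f).
Proof.
elim: n => [|n [un En]] /=.
  by split=> [|f]; [exact: unit_valued_Linf_indic|rewrite mulL_Linf_indic].
have [u e] := adjoint_spec un; split=> [|f]; first exact: u.
by rewrite -e -En -iterSr.
Qed.

(** Both sides say that for every [f >= 0] the mass that [P f] gives to [A] is
    at least the mass that [f] gives to [A]. *)
Lemma absorbing_adjoint A (mA : measurable A) : absorbing P A <->
  \forall x \ae m, \1_A x <= adjoint P (Linf_indic m mA) x.
Proof.
have [u e] := adjoint_spec (unit_valued_Linf_indic mA); split => H.
  apply: (weight_le_of_mass (unit_valued_indic m mA) u) => f f0;
    rewrite -e mulL_Linf_indic -/(resL A f).
  have r0 : \forall x \ae m, 0 <= resL A f x by exact: mulL_ge0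
    (unit_valued_indic m mA) f0.
  rewrite -(markov_mass hP (resL A f)) -(resL_id mA (H _ r0 (resL_out f mA))).
  apply: mass_le; apply: (mulL_le (unit_valued_indic m mA)).
  apply: (markov_le hP); apply: filterS2 (resLE f mA) f0 => x -> fx.
  by rewrite indicE; case: (_ \in _); rewrite ?mul1r// mul0r.
move=> f f0 fA.
have Pf0 := markov_ge0 hP f0.
have : resL A (P f) = P f.
  apply: le_mass_eq.
    apply: filterS2 (resLE (P f) mA) Pf0 => x -> fx.
    by rewrite indicE; case: (_ \in _); rewrite ?mul1r// mul0r.
  apply/le_anti/andP; split.
    apply: mass_le; apply: filterS2 (resLE (P f) mA) Pf0 => x -> fx.
    by rewrite indicE; case: (_ \in _); rewrite ?mul1r// mul0r.
  rewrite (markov_mass hP) -(mulL_Linf_indic mA) e -{1}(resL_id mA fA).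
  apply: mass_le; apply: (ae_mp f0).
  by apply: filterS3 (mulLE f u) (resLE f mA) H => x -> -> ? ?; rewrite ler_wpM2r.
by move=> E; have := resL_out (P f) mA; rewrite E.
Qed.

End AdjointOperator.

(** * Mean ergodicity of functions dominated by an invariant one *)

Section WeightedL2.
Context d (X : measurableType d) (R : realType) (m : probability X R).
Notation V := (L1 m).
Implicit Types f g phi psi : V.
Variables (P : {linear V -> V}) (hP : markov_operator P).
Variables (h : V) (h0 : \forall x \ae m, 0 <= h x) (Ph : P h = h).

Definition dominated f := exists c, \forall x \ae m, `|f x| <= c * h x.

Lemma dominated_vanish f : dominated f -> \forall x \ae m, h x = 0 -> f x = 0.
Proof.
move=> [c]; apply: filterS => x + hx; rewrite hx mulr0 normr_le0.
by move/eqP.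
Qed.

Lemma dominatedD f g : dominated f -> dominated g -> dominated (f + g).
Proof.
move=> [c Hc] [c' Hc']; exists (c + c').
apply: filterS3 Hc Hc' (L1_addE f g) => x a b ->.
by rewrite (le_trans (ler_normD _ _))// mulrDl lerD.
Qed.

Lemma dominatedZ a f : dominated f -> dominated (a *: f).
Proof.
move=> [c Hc]; exists (`|a| * c).
apply: filterS2 Hc (L1_scaleE a f) => x b ->.
by rewrite normrM -mulrA ler_wpM2l.
Qed.

Lemma dominatedB f g : dominated f -> dominated g -> dominated (f - g).
Proof.
by move=> df dg; rewrite -scaleN1r; apply: dominatedD => //; exact: dominatedZ.
Qed.

Lemma dominated_markov f : dominated f -> dominated (P f).
Proof. by move=> [c Hc]; exists c; exact: markov_dominated. Qed.

(** The function [f^2 / h]: the real power -1 is the inverse at nonnegative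
    points and is measurable on the whole line. Where [h] vanishes so does
    [f], and the value is 0. *)
Definition weighted_sq f : V := toL1 m (fun x => f x ^+ 2 * h x `^ (-1)).

Lemma weighted_sqE f : dominated f -> \forall x \ae m, weighted_sq f x = f x ^+
  2 / h x.
Proof.
move=> [c Hc].
have I : m.-integrable setT (EFin \o (fun x => f x ^+ 2 * h x `^ (-1))).
  apply: (@ae_le_integrable _ _ _ m _ (EFin \o absL (c *: f))).
  - apply: measurable_funM; first by apply: measurable_funX; exact: L1_measurable.
    apply: (measurableT_comp (measurable_powR _)); exact: L1_measurable.
  - exact: L1_integrable.
  - apply: (ae_mp h0); apply: (ae_mp Hc).
    apply: filterS2 (absLE (c *: f)) (L1_scaleE c f) => x /= -> -> fh hx.
    rewrite lee_fin powR_inv1// normrM normrX [`|_^-1|]ger0_norm ?invr_ge0//.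
    have [h1|h1] := eqVneq (h x) 0; first by rewrite h1 invr0 mulr0.
    have hp : 0 < h x by rewrite lt_def h1.
    rewrite ler_pdivrMr// expr2 normrM mulrC [leRHS]mulrAC [leRHS]mulrC.
    rewrite ler_wpM2l// (le_trans fh)// ler_wpM2r// ler_norm//.
by apply: filterS2 (toL1E I) h0 => x -> hx; rewrite powR_inv1.
Qed.

(** The squared norm of [f / h] in the Hilbert space L^2 of the measure with
    density [h]. *)
Definition energy f := mass (weighted_sq f).

Lemma weighted_sq_ge0 f : dominated f -> \forall x \ae m, 0 <= weighted_sq f x.
Proof.
by move=> df; apply: filterS2 (weighted_sqE df) h0 => x -> hx;
  rewrite mulr_ge0 ?sqr_ge0// invr_ge0.
Qed.

Lemma energy_ge0 f : dominated f -> 0 <= energy f.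
Proof. by move=> df; apply: mass_ge0; exact: weighted_sq_ge0. Qed.

Lemma energy_parallelogram f g : dominated f -> dominated g ->
  energy (f - g) = 2 * energy f + 2 * energy g - 4 * energy (2^-1 *: (f + g)).
Proof.
move=> df dg; have dfg := dominatedD df dg; have dh := dominatedZ 2^-1 dfg.
rewrite /energy -!massZ -massD -massB; apply: mass_eq.
apply: (ae_mp (weighted_sqE (dominatedB df dg))); apply: (ae_mp (weighted_sqE df)).
apply: (ae_mp (weighted_sqE dg)); apply: (ae_mp (weighted_sqE dh)).
apply: (ae_mp (L1_subE f g)); apply: (ae_mp (L1_addE f g)).
apply: (ae_mp (L1_scaleE 2^-1 (f + g))).
apply: (ae_mp (L1_scaleE 2 (weighted_sq f)));
  apply: (ae_mp (L1_scaleE 2 (weighted_sq g))).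
apply: (ae_mp (L1_scaleE 4 (weighted_sq (2^-1 *: (f + g))))).
apply: (ae_mp (L1_addE (2 *: weighted_sq f) (2 *: weighted_sq g))).
apply: filterS (L1_subE (2 *: weighted_sq f + 2 *: weighted_sq g) (4 *:
  weighted_sq (2^-1 *: (f + g)))).
move=> x -> -> -> -> -> -> -> -> -> -> -> ->; move: (h x)^-1 => v; by field.
Qed.

(** The Cauchy-Schwarz inequality, in the pointwise form [2 |f| <= f^2 / (s h)
    + s h]. Choosing [s] of the order of the square root of the energy bounds
    the norm by that square root. *)
Lemma energy_norm f s : dominated f -> 0 < s -> 2 * `|f| <= energy f / s + s *
  mass h.
Proof.
move=> df s0; rewrite norm_mass /energy mulrC [_ / s]mulrC -!massZ -massD.
rewrite mulrC -massZ; apply: mass_le.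
apply: (ae_mp h0); apply: (ae_mp (dominated_vanish df)).
apply: (ae_mp (weighted_sqE df)); apply: (ae_mp (absLE f)).
apply: (ae_mp (L1_scaleE 2 (absL f)));
  apply: (ae_mp (L1_scaleE s^-1 (weighted_sq f))).
apply: (ae_mp (L1_scaleE s h));
  apply: filterS (L1_addE (s^-1 *: weighted_sq f) (s *: h)).
move=> x -> -> -> -> -> -> H hx.
have [h1|h1] := eqVneq (h x) 0; first by rewrite H// h1 normr0 invr0 !mulr0 addr0.
have hp : 0 < h x by rewrite lt_def h1.
rewrite -subr_ge0 -[f x ^+ 2]real_normK ?num_real//.
have -> : s^-1 * (`|f x| ^+ 2 / h x) + s * h x - 2 * `|f x|
  = (`|f x| - s * h x) ^+ 2 / (s * h x) by field; rewrite h1 lt0r_neq0.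
by rewrite divr_ge0 ?sqr_ge0// mulr_ge0// ltW.
Qed.

(** Rational points suffice to see that the minimum of the quadratic
    polynomial, attained at [b / c], is nonnegative. *)
Lemma quadratic_rat (a b c : R) : 0 < c ->
  (forall t : rat, 0 <= a - 2 * ratr t * b + ratr t ^+ 2 * c) -> b ^+ 2 / c <= a.
Proof.
move=> c0 H; rewrite leNgt; apply/negP => lt.
pose D := b ^+ 2 / c - a; have D0 : 0 < D by rewrite subr_gt0.
(* At a distance less than this from the minimum, the polynomial has not yet
   gained the amount D by which the minimum would be negative. *)
pose eta := Num.min 1 (D / (2 * c)).
have eta0 : 0 < eta by rewrite lt_min ltr01 divr_gt0// mulr_gt0.
have [t] := rat_in_itvoo (ltr_pwDr eta0 (lexx (b / c))).
rewrite in_itv /= => /andP[t1 t2].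
have := H t; apply/negP; rewrite -ltNge.
pose s := ratr t - b / c.
have -> : a - 2 * ratr t * b + ratr t ^+ 2 * c = c * s ^+ 2 - D.
  by rewrite /s /D; field; rewrite lt0r_neq0.
have s0 : 0 < s by rewrite subr_gt0.
have se : s < eta by rewrite ltrBlDl.
have e1 : eta <= 1 by rewrite ge_min lexx.
have e2 : c * eta <= D / 2.
  have : eta <= D / (2 * c) by rewrite ge_min lexx orbT.
  by rewrite ler_pdivlMr ?mulr_gt0// => ?; lra.
rewrite subr_lt0 (@le_lt_trans _ _ (c * eta))//; last by lra.
rewrite ler_wpM2l ?(ltW c0)// expr2; nra.
Qed.

(** The function [(f - t h)^2 / h] is nonnegative, so its image [P(f^2 / h) -
    2 t P f + t^2 h] is nonnegative almost everywhere. Restricting [t] to the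
    rationals keeps the union of the exceptional sets null, and [t] may then
    depend on the point. *)
Lemma markov_jensen f : dominated f ->
  \forall x \ae m, (P f x) ^+ 2 / h x <= P (weighted_sq f) x.
Proof.
move=> df.
have key (t : R) : \forall x \ae m, 0 <= P (weighted_sq f) x - 2 * t * P f x +
  t ^+ 2 * h x.
  have : \forall x \ae m, 0 <= P (weighted_sq f - (2 * t) *: f + t ^+ 2 *: h) x.
    apply: (markov_ge0 hP); apply: (ae_mp h0); apply: (ae_mp (dominated_vanish df)).
    apply: (ae_mp (weighted_sqE df)).
    apply: (ae_mp (L1_scaleE (2 * t) f)); apply: (ae_mp (L1_scaleE (t ^+ 2) h)).
    apply: (ae_mp (L1_subE (weighted_sq f) ((2 * t) *: f))).
    apply: filterS (L1_addE (weighted_sq f - (2 * t) *: f) (t ^+ 2 *: h)).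
    move=> x -> -> -> -> -> H hx.
    have [h1|h1] := eqVneq (h x) 0;
      first by rewrite H// h1 invr0 !mulr0 subr0 addr0.
    have -> : f x ^+ 2 / h x - 2 * t * f x + t ^+ 2 * h x = (f x - t * h x) ^+
      2 / h x.
      by field.
    by rewrite mulr_ge0 ?sqr_ge0// invr_ge0.
  have -> : P (weighted_sq f - (2 * t) *: f + t ^+ 2 *: h) =
      P (weighted_sq f) - (2 * t) *: P f + t ^+ 2 *: h.
    by rewrite (linearD P) (linearB P) !markovZ Ph.
  move=> H0; apply: (ae_mp H0).
  apply: (ae_mp (L1_scaleE (2 * t) (P f))); apply: (ae_mp (L1_scaleE (t ^+ 2) h)).
  apply: (ae_mp (L1_subE (P (weighted_sq f)) ((2 * t) *: P f))).
  apply: filterS (L1_addE (P (weighted_sq f) - (2 * t) *: P f) (t ^+ 2 *: h)).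
  by move=> x -> -> -> ->.
have keyQ : \forall x \ae m, forall t : rat,
    0 <= P (weighted_sq f) x - 2 * ratr t * P f x + ratr t ^+ 2 * h x.
  have := ae_foralln (fun n => key (ratr (odflt 0 (unpickle n)))).
  by apply: filterS => x H t; have := H (pickle t); rewrite pickleK.
apply: (ae_mp h0); apply: (ae_mp keyQ).
apply: filterS2 (dominated_vanish (dominated_markov df)) (markov_ge0 hP
  (weighted_sq_ge0 df)).
move=> x H1 H2 H3 hx.
have [h1|h1] := eqVneq (h x) 0; first by rewrite h1 invr0 mulr0.
by apply: quadratic_rat => //; rewrite lt_def h1.
Qed.

Lemma energy_markov f : dominated f -> energy (P f) <= energy f.
Proof.
move=> df; rewrite /energy -(markov_mass hP (weighted_sq f)); apply: mass_le.
by apply: filterS2 (markov_jensen df) (weighted_sqE (dominated_markov df)) => x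
  a ->.
Qed.

(** The mean ergodic theorem of von Neumann, with the proof of F. Riesz. Among
    the functions [f - (u - P u)], a convex set stable under [P], take a
    sequence whose energies approach the infimum. Since midpoints stay in the
    set, the parallelogram law makes it a Cauchy sequence. As [P] does not
    increase the energy, the images under [P] of the sequence also approach
    the infimum and are therefore asymptotic to the sequence, so that its
    limit is invariant. *)
Lemma dominated_ergodic f : dominated f -> ergodic_decomposable P f.
Proof.
move=> df.
pose C y := exists u, dominated u /\ y = f - (u - P u).
have Cdom y : C y -> dominated y.
  move=> [u [du ->]]; apply: dominatedB => //; apply: dominatedB => //;
    exact: dominated_markov.
have CP y : C y -> C (P y).
  move=> Cy; have dy := Cdom _ Cy; case: Cy => u [du e].
  exists (u + y); split; first exact: dominatedD.
  by rewrite (linearD P) [- (P u + _)]opprD addrACA opprD addrA -e subKr.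
have Cmid y z : C y -> C z -> C (2^-1 *: (y + z)).
  move=> [u [du ->]] [v [dv ->]]; exists (2^-1 *: (u + v)); split.
    by apply: dominatedZ; exact: dominatedD.
  rewrite markovZ (linearD P) -scalerBr.
  have -> : u + v - (P u + P v) = (u - P u) + (v - P v) by rewrite opprD addrACA.
  rewrite [X in _ *: X]addrACA -opprD scalerBr; congr (_ - _).
  by rewrite -mulr2n -[f *+ 2]scaler_nat scalerA mulVf// scale1r.
pose S := [set energy y | y in C].
have S0 : S (energy f).
  exists f => //; exists 0; split; last by rewrite linear0 !subr0.
  exists 0; apply: filterS (L1_0E m) => x ->; by rewrite normr0 mul0r.
have Slb : has_lbound S.
  by exists 0 => _ [y /Cdom dy <-]; exact: energy_ge0.
pose mu := inf S.
have mule y : C y -> mu <= energy y by move=> Cy; apply: ge_inf;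
  [exact: Slb|exists y].
have close y z e : C y -> C z -> energy y <= mu + e -> energy z <= mu + e ->
  energy (y - z) <= 4 * e.
  move=> Cy Cz Qy Qz; rewrite energy_parallelogram; [|exact: Cdom..].
  by have := mule _ (Cmid _ _ Cy Cz);
    move: (energy _) (energy y) (energy z) Qy Qz => q1 q2 q3; lra.
pose e_ (k : nat) : R := (2^-1) ^+ k.
have e_0 k : 0 < e_ k by rewrite exprn_gt0// invr_gt0.
have /choice[y hy] : forall k, exists y, C y /\ energy y <= mu + e_ k ^+ 2.
  move=> k; have lt : mu < mu + e_ k ^+ 2 by rewrite ltrDl exprn_gt0.
  have [_ [z Cz <-] lt'] := inf_lt (ex_intro _ _ S0) lt.
  by exists z; split; [exact: Cz|exact: ltW].
have e_mono i j : (i <= j)%N -> e_ j <= e_ i.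
  by move=> ij; rewrite /e_ ler_wiXn2l// invf_le1// ler1n.
(* Applied below both with z = y n for n >= k and with z = P (y k). *)
have Qb k z : C z -> energy z <= mu + e_ k ^+ 2 -> `|y k - z| <= e_ k * (2 +
  mass h).
  move=> Cz Qz; have Q4 := close _ _ _ (hy k).1 Cz (hy k).2 Qz.
  have dd : dominated (y k - z) by apply: dominatedB; apply: Cdom => //;
    exact: (hy k).1.
  have := energy_norm dd (e_0 k).
  have : energy (y k - z) / e_ k <= 4 * e_ k by rewrite ler_pdivrMr// -mulrA -expr2.
  have : 0 <= mass h by exact: mass_ge0.
  have := e_0 k; nra.
have e_cvg e : 0 < e -> exists k, e_ k * (2 + mass h) <= e.
  move=> e0.
  have : geometric (2 + mass h) 2^-1 k @[k --> \oo] --> (0 : R).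
    by apply: cvg_geometric; rewrite ger0_norm ?invr_ge0// invf_lt1// ltr1n.
  move/cvgrPdist_le => /(_ _ e0) [k _ /(_ k (leqnn k))].
  rewrite /= sub0r normrN => H; exists k; rewrite mulrC.
  exact: le_trans (ler_norm _) H.
have [e e0|g yg] := @L1_complete _ _ _ m y.
  have [k ke] := e_cvg _ e0.
  exists (y k); exists k => // n /= kn; rewrite distrC (le_trans _ ke)// Qb//.
    exact: (hy n).1.
  by rewrite (le_trans (hy n).2)// lerD2l ler_sqr ?nnegrE ?(ltW (e_0 _))// e_mono.
have Pg : P g = g.
  apply/eqP; rewrite -subr_eq0 -normr_le0; apply/ler_addgt0Pr => e e0;
    rewrite add0r.
  have e3 : 0 < e / 3 by rewrite divr_gt0.
  have [k0 ke] := e_cvg _ e3.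
  move/cvgrPdist_le : yg => /(_ _ e3) [k1 _ /(_ (maxn k0 k1) (leq_maxr _ _))].
  set k := maxn k0 k1 => gk.
  have Pyk : `|y k - P (y k)| <= e / 3.
    rewrite (le_trans (Qb k _ (CP _ (hy k).1) _))//.
      exact: le_trans (energy_markov (Cdom _ (hy k).1)) (hy k).2.
    rewrite (le_trans _ ke)// ler_wpM2r ?e_mono ?leq_maxl//.
    by rewrite addr_ge0// mass_ge0.
  have -> : P g - g = P (g - y k) - (y k - P (y k)) - (g - y k).
    by rewrite (linearB P) opprB addrA subrK opprB addrA subrK.
  rewrite (le_trans (ler_normB _ _))// (_ : e = e / 3 + e / 3 + e / 3);
    last by field.
  rewrite lerD// (le_trans (ler_normB _ _))// lerD//.
  exact: le_trans (markov_norm hP _) gk.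
move=> e e0; move/cvgrPdist_le : yg => /(_ _ e0) [k _ /(_ k (leqnn k)) H].
have [u [_ yu]] := (hy k).1.
by exists u, g; split => //; rewrite -yu distrC.
Qed.
End WeightedL2.

(** * Ergodic densities, decomposable functions and maximal support *)

Section Reductions.
Context d (X : measurableType d) (R : realType) (m : probability X R).
Notation V := (L1 m).
Implicit Types f g phi psi : V.
Variables (P : {linear V -> V}) (hP : markov_operator P).

Lemma disjoint_suppE f g : m (supp f `&` supp g) = 0%E <->
  \forall x \ae m, f x = 0 \/ g x = 0.
Proof.
have mI : measurable (supp f `&` supp g) by apply: measurableI;
  exact: measurable_supp.
have E : supp f `&` supp g = ~` [set x | f x = 0 \/ g x = 0].
  apply/seteqP; split => x /=; rewrite /supp /=.
    by move=> [/eqP a /eqP b] [].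
  by move/not_orP => [/eqP a /eqP b].
split=> [H|H]; last by apply/negligibleP => //; rewrite E; exact: H.
have : m.-negligible (supp f `&` supp g) by apply/negligibleP.
by rewrite E.
Qed.

Lemma invariant_densityE h : invariant_density P h <->
  [/\ \forall x \ae m, 0 <= h x, mass h = 1 & P h = h].
Proof.
split=> [[[h0 h1] Ph]|[h0 h1 Ph]].
  by split; [exact: h0|rewrite -h1 norm_ge0_mass|exact: Ph].
by split; [split; [exact: h0|rewrite norm_ge0_mass]|exact: Ph].
Qed.

Lemma ergodic_densityE h : ergodic_density P h <->
  invariant_density P h /\ absorbing_trivial P h.
Proof.
split=> [[ih eh]|[ih eh]]; (split; first exact: ih) => A mA.
  move=> /(absorbing_adjoint hP mA) /eh; rewrite -mass_resL// => -[] [e].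
    by left.
  by right.
move=> /(absorbing_adjoint hP mA) /(eh _ mA); rewrite -mass_resL// => -[->|->].
  by left.
by right.
Qed.

Notation decomposable := (ergodic_decomposable P).

Lemma decomposableD f g : decomposable f -> decomposable g -> decomposable (f + g).
Proof.
move=> hf hg e e0; have e2 : 0 < e / 2 by rewrite divr_gt0.
have [u [f' [Pf' fe]]] := hf _ e2; have [v [g' [Pg' ge]]] := hg _ e2.
exists (u + v), (f' + g'); split; first by rewrite linearD Pf' Pg'.
have -> : f + g - (u + v - P (u + v)) - (f' + g') =
    (f - (u - P u) - f') + (g - (v - P v) - g').
  rewrite (linearD P).
  have -> : u + v - (P u + P v) = (u - P u) + (v - P v) by rewrite opprD addrACA.
  set a := u - P u; set b := v - P v.
  by rewrite [- (a + b)]opprD [f + g + _]addrACA [- (f' + g')]opprD [LHS]addrACA.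
by rewrite (le_trans (ler_normD _ _))// [e]splitr lerD.
Qed.

Lemma decomposable0 : decomposable 0.
Proof.
move=> e e0; exists 0, 0; split; first exact: linear0.
by rewrite linear0 !subr0 normr0 ltW.
Qed.

Lemma decomposable_sum n (F : 'I_n -> V) : (forall i, decomposable (F i)) ->
  decomposable (\sum_(i < n) F i).
Proof. by move=> H; apply: (big_ind decomposable) => //;
  [exact: decomposable0|exact: decomposableD]. Qed.

Lemma decomposable_coboundary u : decomposable (u - P u).
Proof.
move=> e e0; exists u, 0; split; first exact: linear0.
by rewrite subr0 subrr normr0 ltW.
Qed.

Lemma decomposable_closed f : (forall e, 0 < e -> exists g, decomposable g /\
  `|f - g| <= e) -> decomposable f.
Proof.
move=> H e e0; have e2 : 0 < e / 2 by rewrite divr_gt0.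
have [g [/(_ _ e2) [u [g' [Pg' ge]]] fg]] := H _ e2.
exists u, g'; split => //.
have -> : f - (u - P u) - g' = (f - g) + (g - (u - P u) - g').
  by rewrite !addrA subrK.
by rewrite (le_trans (ler_normD _ _))// [e]splitr lerD.
Qed.

(** By truncation, functions dominated by [h] are dense among those carried by
    the support of [h]. *)
Lemma decomposable_supported (h f : V) : (\forall x \ae m, 0 <= h x) -> P h = h ->
  (\forall x \ae m, h x = 0 -> f x = 0) -> decomposable f.
Proof.
move=> h0 Ph hf; apply: decomposable_closed => e e0.
have [psi [c [pc le]]] := truncation_dense h0 hf e0.
by exists psi; split => //; apply: (dominated_ergodic hP h0 Ph); exists c.
Qed.

Lemma cvg_mul_to1 (a : R^nat) (b : R) : a n @[n --> \oo] --> (1 : R) ->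
  a n * b @[n --> \oo] --> b.
Proof.
move=> H; have : a n * b @[n --> \oo] --> 1 * b by exact: cvgMr_tmp.
by rewrite mul1r.
Qed.

(** The mass of [P^n |f|] outside the support of [h] is the integral of [|f|]
    against one minus the n-th adjoint iterate of the indicator. This
    integrand tends to 0 and is dominated by [|f|]. *)
Lemma maximal_support_escape h : maximal_support P h -> forall f,
  `|resL (~` supp h) (iter n P f)| @[n --> \oo] --> (0 : R).
Proof.
move=> Hm f; pose mS := measurable_supp h; have mSC := measurableC mS.
pose G n := iter n (adjoint P) (Linf_indic m mS).
have uG n : unit_valued m (G n) by exact: (adjoint_iter hP mS n).1.
have cG : mulL (G n) (absL f) @[n --> \oo] --> absL f.
  apply: (@L1_dominated_cvg _ _ _ m _ _ (absL f)).
    apply: filterS2 Hm (ae_foralln (fun n => mulLE (absL f) (uG n))) => x Hx e1.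
    under eq_fun do rewrite e1.
    exact: (@cvg_mul_to1 (fun n => G n x) (absL f x) Hx).
  move=> n; apply: filterS3 (uG n).2 (mulLE (absL f) (uG n)) (absLE f) => x
    /andP[a b] -> ->.
  by rewrite normrM normr_id ger0_norm// ler_piMl.
have bound n : `|resL (~` supp h) (iter n P f)| <= `|absL f - mulL (G n) (absL f)|.
  have a0 : \forall x \ae m, 0 <= absL f x by apply: filterS (absLE f) => x ->.
  apply: (@le_trans _ _ (mass (resL (~` supp h) (iter n P (absL f))))).
    rewrite norm_mass; apply: mass_le.
    apply: (ae_mp (iter_abs hP n f));
      apply: (ae_mp (absLE (resL (~` supp h) (iter n P f)))).
    apply: filterS2 (resLE (iter n P f) mSC) (resLE (iter n P (absL f)) mSC) =>
      x -> -> -> H.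
    by rewrite normrM ger0_norm// ler_wpM2l.
  have -> : mass (resL (~` supp h) (iter n P (absL f))) = mass (absL f - mulL
    (G n) (absL f)).
    rewrite massB -(adjoint_iter hP mS n).2 -(iter_mass hP n (absL f)).
    rewrite [X in _ = mass X - _](resLC (iter n P (absL f)) mS) massD.
    by rewrite addrC addKr.
  exact: le_trans (ler_norm _) (mass_le_norm _).
apply: (@squeeze_cvgr _ _ _ _ (cst 0) (fun n => `|mulL (G n) (absL f) - absL f|)).
- by apply: nearW => n; rewrite normr_ge0 distrC bound.
- exact: cvg_cst.
- by apply/norm_cvg0P/subr_cvg0.
Qed.
End Reductions.

(** * From ergodic densities to convergence of the averages, and back to constrictivity *)

Section FiniteErgodicToPeriodic.
Context d (X : measurableType d) (R : realType) (m : probability X R).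
Notation V := (L1 m).
Implicit Types f g phi psi : V.
Variables (P : {linear V -> V}) (hP : markov_operator P).
Notation A_ := (cesaro_mean P).

Lemma cesaro_lim_norm f g : A_ n f @[n --> \oo] --> g -> `|g| <= `|f|.
Proof.
move=> fg; apply/ler_addgt0Pr => e e0.
move/cvgrPdist_le : fg => /(_ _ e0) [n _ /(_ n (leqnn n)) H].
rewrite -[g](subrK (A_ n f)) (le_trans (ler_normD _ _))// addrC lerD//.
exact: cesaro_norm.
Qed.

Lemma mass_resL_continuous (A : set X) (u : V^nat) g : measurable A ->
  u n @[n --> \oo] --> g -> mass (resL A (u n)) @[n --> \oo] --> mass (resL A g).
Proof.
move=> mA ug; apply/cvgrPdist_le => e e0.
move/cvgrPdist_le : ug => /(_ _ e0); apply: filterS => n H.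
rewrite -massB -resLB// (le_trans (mass_le_norm _))//.
by rewrite (le_trans (mulL_norm _ (unit_valued_indic m mA))).
Qed.

Lemma sum_resL_supp r (h : 'I_r -> V) f : disjoint_supports h ->
  (\forall x \ae m, \sum_(i < r) h i x = 0 -> f x = 0) ->
  f = \sum_(i < r) resL (supp (h i)) f.
Proof.
move=> dh hf; apply: L1_eq.
have dis : \forall x \ae m, forall i j : 'I_r, i != j -> h i x = 0 \/ h j x = 0.
  apply: filter_forall => i; apply: filter_forall => j.
  have [ij|ij] := eqVneq i j; first by apply: aeW.
  by have /disjoint_suppE := dh i j ij; apply: filterS.
have res : \forall x \ae m, forall i : 'I_r, resL (supp (h i)) f x = \1_(supp
  (h i)) x * f x.
  by apply: filter_forall => i; apply: resLE; exact: measurable_supp.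
apply: (ae_mp dis); apply: (ae_mp hf).
apply: filterS2 res (L1_sumE (index_enum 'I_r) (fun i => resL (supp (h i)) f))
  => x rx -> sx dx.
have [[i hi]|nh] := pselect (exists i, h i x != 0).
  rewrite (bigD1 i)//= big1 ?addr0.
    by rewrite rx indicE mem_set ?mul1r.
  move=> j ji; rewrite rx indicE memNset ?mul0r// /supp /=.
  by case: (dx j i ji) => [->|e]; rewrite ?eqxx//; rewrite e eqxx in hi.
have h0 i : h i x = 0.
  by apply/eqP; apply: contra_notT nh => hi; exists i.
rewrite sx; last by rewrite big1.
by rewrite big1// => i _; rewrite rx indicE memNset ?mul0r// /supp /= h0 eqxx.
Qed.

Lemma averageE r (h : 'I_r -> V) : \forall x \ae m,
  (r%:R^-1 *: \sum_(i < r) h i : V) x = r%:R^-1 * \sum_(i < r) h i x.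
Proof.
by apply: filterS2 (L1_scaleE (r%:R^-1 : R) (\sum_(i < r) h i))
  (L1_sumE (index_enum 'I_r) h) => x -> ->.
Qed.

(** The supports of the [h i] cover [supp hb], and the part of [P^k f] outside
    [supp hb] tends to 0. Since [f - P^k f] is a coboundary and functions
    carried by the support of one [h i] are decomposable, every [f] is
    decomposable, and its averages converge to some invariant [E f]. Being
    invariant, [E f] is carried by [supp hb]. Its restriction to the absorbing
    set [supp (h i)] is again invariant, hence is a multiple of [h i] by
    ergodicity. *)
Lemma ergodic_densities_periodic : finite_ergodic_densities P ->
  asymptotically_periodic_in_mean P.
Proof.
move=> [r [h [r0 eh dh Hm]]].
have hI i : [/\ \forall x \ae m, 0 <= h i x, mass (h i) = 1, P (h i) = h i &
  absorbing_trivial P (h i)].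
  by have [/invariant_densityE [? ? ?] ?] := (ergodic_densityE hP (h i)).1 (eh i).
set hb : V := _ *: _ in Hm.
have r1 : (r%:R^-1 : R) != 0 by rewrite invr_eq0 pnatr_eq0 -lt0n.
have hb0 f : (\forall x \ae m, hb x = 0 -> f x = 0) ->
    \forall x \ae m, \sum_(i < r) h i x = 0 -> f x = 0.
  by apply: filterS2 (averageE h) => x -> H e; apply: H; rewrite e mulr0.
have mS := measurable_supp hb; have mSC := measurableC mS.
have all_decomposable f : ergodic_decomposable P f.
  apply: decomposable_closed => e e0.
  have /cvgrPdist_le /(_ _ e0) [k _ /(_ k (leqnn k))] := maximal_support_escape
    hP Hm f.
  rewrite sub0r normrN normr_id => Hk.
  exists (f - resL (~` supp hb) (iter k P f)); split; last by rewrite subKr.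
  have -> : f - resL (~` supp hb) (iter k P f) = (f - iter k P f) + resL (supp
    hb) (iter k P f).
    by rewrite {2}(resLC (iter k P f) mS) opprD addrA addrAC subrK.
  apply: decomposableD.
    elim: k {Hk} => [|k IH] /=; first by rewrite subrr; exact: decomposable0.
    have -> : f - P (iter k P f) = (f - iter k P f) + (iter k P f - P (iter k P f)).
      by rewrite addrA subrK.
    exact: decomposableD IH (@decomposable_coboundary _ _ _ _ P (iter k P f)).
  rewrite (@sum_resL_supp _ h (resL (supp hb) (iter k P f)))//.
    apply: decomposable_sum => i; have [hi0 _ Phi _] := hI i.
    apply: (decomposable_supported hP hi0 Phi).
    apply: filterS (resL_out (resL (supp hb) (iter k P f)) (measurable_supp (h
      i))) => x H xe.
    by apply: H; rewrite /supp /= xe eqxx.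
  apply: hb0; apply: filterS (resL_out (iter k P f) mS) => x H xe.
  by apply: H; rewrite /supp /= xe eqxx.
have /choice[E HE] f := mean_ergodic hP (all_decomposable f).
have E_supp f : \forall x \ae m, hb x = 0 -> E f x = 0.
  have E0 : resL (~` supp hb) (E f) = 0.
    apply/eqP; rewrite -normr_eq0; apply/eqP.
    have := maximal_support_escape hP Hm (E f).
    under eq_fun do rewrite (iter_invariant _ (HE f).1).
    by move/(cvg_unique (@Rhausdorff R) (cvg_cst _)).
  have := resL_in (E f) mSC; rewrite E0; apply: filterS2 (L1_0E m) => x e H hx.
  by rewrite -H ?e// /supp /= hx eqxx.
pose L i f := mass (resL (supp (h i)) (E f)).
have EL f : E f = \sum_(i < r) L i f *: h i.
  rewrite {1}(@sum_resL_supp _ h (E f) dh); last by apply: hb0; exact: E_supp.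
  apply: eq_bigr => i _; have [hi0 hi1 Phi ehi] := hI i.
  apply: (ergodic_unique hP hi0 hi1 Phi ehi).
    apply: (invariant_resL hP);
      [exact: measurable_supp|exact: supp_absorbing|exact: (HE f).1].
  apply: filterS (resL_out (E f) (measurable_supp (h i))) => x H xe.
  by apply: H; rewrite /supp /= xe eqxx.
have Elin a f g : E (a *: f + g) = a *: E f + E g.
  apply: (cvg_unique (@norm_hausdorff _ V) (HE _).2).
  have -> : (fun n => A_ n (a *: f + g)) = (fun n => a *: A_ n f + A_ n g).
    by apply/funext => n; exact: cesaro_linear.
  by apply: cvgD; [apply: cvgZl_tmp; exact: (HE f).2|exact: (HE g).2].
have Llin i : forall a f g, L i (a *: f + g) = a * L i f + L i g.
  move=> a f g; have mi := measurable_supp (h i).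
  by rewrite /L Elin resLD// resLZ// massD massZ.
have /choice[lam lamE] i : exists l : {scalar V}, forall f, l f = L i f.
  have lin : GRing.linear_for *%R (L i) by move=> a f g; exact: Llin.
  pose l : {scalar V} := HB.pack (L i) (GRing.isLinear.Build R V R *%R (L i) lin).
  by exists l.
exists r, h, lam; split => //.
- move=> i; have mi := measurable_supp (h i); split.
    move=> f f0; rewrite lamE.
    have := mass_resL_continuous mi (HE f).2.
    apply: (@closed_cvg _ _ _ _ _ [set y : R | 0 <= y]); first exact: closed_ge.
    by apply: nearW => n; apply: mass_ge0; apply: mulL_ge0;
      [exact: unit_valued_indic|exact: cesaro_ge0].
  exists 1 => f; rewrite lamE mul1r (le_trans (mass_le_norm _))//.
  rewrite (le_trans (mulL_norm _ (unit_valued_indic m mi)))//.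
  exact: cesaro_lim_norm (HE f).2.
- move=> f; under eq_fun do under eq_bigr do rewrite lamE.
  by rewrite -EL; apply/norm_cvg0P/subr_cvg0; exact: (HE f).2.
Qed.

(** By induction on [r], as the image of a segment times a compact set. *)
Lemma compact_box r (h : 'I_r -> V) (C : 'I_r -> R) :
  compact [set \sum_(i < r) t i *: h i | t in [set t : 'I_r -> R | forall i,
    `|t i| <= C i]].
Proof.
elim: r h C => [|r IH] h C.
  rewrite (_ : image _ _ = [set 0]); first exact: compact_set1.
  apply/seteqP; split => [_ [t _ <-]|_ ->]; first by rewrite /= big_ord0.
  by exists (fun=> 0); rewrite ?big_ord0//; case.
have cIH := IH (fun i => h (lift ord0 i)) (fun i => C (lift ord0 i)).
have cseg := @segment_compact R (- C ord0) (C ord0).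
have := compact_setX cseg cIH.
move/(continuous_compact (f := fun p : R * V => p.1 *: h ord0 + p.2)) => H.
rewrite (_ : image _ _ = [set p.1 *: h ord0 + p.2 | p in `[- C ord0, C ord0] `*`
  [set \sum_(i < r) t i *: h (lift ord0 i) | t in [set t | forall i, `|t i| <=
    C (lift ord0 i)]]]).
  apply: H; apply: continuous_subspaceT => p.
  apply: cvgD; last exact: cvg_snd.
  apply: cvgZr_tmp; exact: cvg_fst.
apply/seteqP; split => [_ [t tC <-]|_ [[s v] [/= sC [t tC <-]] <-]].
  exists (t ord0, \sum_(i < r) t (lift ord0 i) *: h (lift ord0 i)) => /=.
    split => /=; first by rewrite in_itv /= -ler_norml.
    by exists (fun i => t (lift ord0 i)).
  by rewrite big_ord_recl.
exists (fun i => if unlift ord0 i is Some j then t j else s).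
  move=> i; case: unliftP => [j ->|->]; first exact: tC.
  by rewrite ler_norml; move: sC; rewrite in_itv.
rewrite big_ord_recl unlift_none; congr (_ + _).
by apply: eq_bigr => i _; rewrite liftK.
Qed.

Lemma periodic_constrictive : asymptotically_periodic_in_mean P ->
  mean_constrictive P.
Proof.
move=> [r [h [lam [_ _ _ Hl Hc]]]].
have /choice[C HC] i : exists C : R, forall f, `|lam i f| <= C * `|f| := (Hl i).2.
exists [set \sum_(i < r) t i *: h i | t in [set t : 'I_r -> R | forall i, `|t
  i| <= C i]].
split; first exact: compact_box.
move=> f [_ f1].
apply: (@squeeze_cvge _ _ _ _ (cst 0%E) _
  (fun n => (`|A_ n f - \sum_(i < r) lam i f *: h i|)%:E)).
- apply: nearW => n; apply/andP; split.
    by apply: le_ereal_inf_tmp => _ [psi _ <-]; rewrite lee_fin.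
  apply: ereal_inf_lbound; exists (\sum_(i < r) lam i f *: h i) => //.
  exists (fun i => lam i f) => // i.
  by rewrite (le_trans (HC i f))// f1 mulr1.
- exact: cvg_cst.
- by apply: cvg_EFin; [exact: nearW|exact: Hc].
Qed.
End FiniteErgodicToPeriodic.

(** * From mean constrictivity to finitely many ergodic densities *)

Section MeanConstrictive.
Context d (X : measurableType d) (R : realType) (m : probability X R).
Notation V := (L1 m).
Implicit Types f g phi psi : V.

(** The pointwise limit is at most 1 and has integral 1. *)
Lemma unit_valued_mono_cvg1 (G : nat -> X -> R) : (forall n, unit_valued m (G n)) ->
  (forall n, \forall x \ae m, G n x <= G n.+1 x) ->
  mass (toL1 m (G n)) @[n --> \oo] --> (1 : R) ->
  \forall x \ae m, G n x @[n --> \oo] --> (1 : R).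
Proof.
move=> uG Gm G1.
(* The upper limit is measurable and equals the limit where the latter exists.
   *)
pose g x := fine (limn_esup (fun n => (G n x)%:E)).
have cg : \forall x \ae m, G n x @[n --> \oo] --> g x.
  apply: filterS2 (ae_foralln Gm) (ae_foralln (fun n => (uG n).2)) => x mx bx.
  have : cvgn (fun n => G n x).
    apply: nondecreasing_is_cvgn; first by apply/nondecreasing_seqP.
    by exists 1 => _ [n _ <-]; have /andP[] := bx n.
  move=> /[dup] yc /cvg_lim.
  suff -> : g x = limn (fun n => G n x) by [].
  rewrite /g (@cvg_limn_einf_sup _ _ (limn (fun n => G n x))%:E)//.
  by apply: cvg_EFin => //; exact: nearW.
have mg : measurable_fun setT g.
  apply: measurableT_comp => //; apply: measurable_fun_limn_esup => n.
  exact/measurable_EFinP/(uG n).1.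
have ug : unit_valued m g.
  split; first exact: mg.
  apply: filterS2 cg (ae_foralln (fun n => (uG n).2)) => x gx bx.
  apply/andP; split.
    apply: (@closed_cvg _ _ _ _ (fun n => G n x) [set y : R | 0 <= y]) gx;
      first exact: closed_ge.
    by apply: nearW => n; have /andP[] := bx n.
  apply: (@closed_cvg _ _ _ _ (fun n => G n x) [set y : R | y <= 1]) gx;
    first exact: closed_le.
  by apply: nearW => n; have /andP[] := bx n.
have cL : (toL1 m (G n) : V) @[n --> \oo] --> toL1 m g.
  apply: (@L1_dominated_cvg _ _ _ m _ _ (toL1 m (cst 1))).
    apply: filterS3 cg (toL1_unit_valued ug) (ae_foralln (fun n =>
      toL1_unit_valued (uG n))) => x a -> e1.
    by under eq_fun do rewrite e1.
  move=> n; apply: filterS3 (uG n).2 (toL1_unit_valued (uG n))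
    (toL1_unit_valued (unit_valued1 m)).
  by move=> x /andP[a b] -> ->; rewrite ger0_norm.
have gE : toL1 m g = toL1 m (cst 1).
  apply: le_mass_eq.
    by apply: filterS3 ug.2 (toL1_unit_valued ug) (toL1_unit_valued
      (unit_valued1 m)) => x /andP[_ b] -> ->.
  rewrite mass_one; apply: (cvg_unique (@Rhausdorff R) _ G1).
  apply/cvgrPdist_le => e e0; move/cvgrPdist_le : cL => /(_ _ e0).
  by apply: filterS => n H; rewrite -massB (le_trans (mass_le_norm _)).
apply: filterS3 cg (toL1_unit_valued ug) (toL1_unit_valued (unit_valued1 m)) =>
  x a e1 e2.
by move: a; rewrite -e1 gE e2.
Qed.

Variables (P : {linear V -> V}) (hP : markov_operator P).
Notation A_ := (cesaro_mean P).

(** Pick points of [F] closer and closer to the averages; compactness gives a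
    cluster point of them. *)
Lemma constrictive_cluster (F : set V) f : compact F ->
  dist_set (A_ n f) F @[n --> \oo] --> 0%E ->
  exists2 g, F g & forall e N, 0 < e -> exists n, (N <= n)%N /\ `|A_ n f - g| <= e.
Proof.
move=> cF dF.
have pick (k : nat) : exists q : nat * V,
    [/\ (k <= q.1)%N, F q.2 & `|A_ q.1 f - q.2| < k.+1%:R^-1].
  have k0 : (0 < (k.+1%:R^-1 : R)%:E)%E by rewrite lte_fin invr_gt0.
  have [N _ HN] := dF _ (open_ereal_lt' k0).
  have := HN (maxn N k) (leq_maxl _ _).
  move/ereal_inf_lt => [_ [psi Fpsi <-]]; rewrite lte_fin => H.
  by exists (maxn N k, psi); rewrite /= leq_maxr.
have /choice[q hq] := pick.
have [g [Fg clg]] : (F `&` cluster ((fun k => (q k).2) @ \oo)) !=set0.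
  by apply: cF; exists 0%N => // k _ /=; have [] := hq k.
exists g => // e N e0.
have e2 : 0 < e / 2 by rewrite divr_gt0.
have [K _ HK] : \forall k \near \oo, (k.+1%:R^-1 : R) <= e / 2.
  have /cvgrPdist_le /(_ _ e2) := @cvg_harmonic R.
  by apply: filterS => k; rewrite sub0r normrN /harmonic /= ger0_norm ?invr_ge0.
have [] := clg [set (q k).2 | k in [set k | (maxn N K <= k)%N]] (ball g (e / 2)).
- by exists (maxn N K) => // k /= kN; exists k.
- exact: nbhsx_ballx.
move=> _ [[k /= Nk <-]]; rewrite -ball_normE /= => gq.
have [kq _ Aq] := hq k.
exists (q k).1; split; first by rewrite (leq_trans _ kq)// (leq_trans _ Nk)//
  leq_maxl.
rewrite -[A_ _ f](subrK (q k).2) -addrA (le_trans (ler_normD _ _))// [e]splitr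
  lerD//.
  rewrite (le_trans (ltW Aq))//; apply: HK;
    rewrite /= (leq_trans _ Nk)// leq_maxr//.
by rewrite distrC ltW.
Qed.

Definition disjoint_family r (h : 'I_r -> V) :=
  (forall i, invariant_density P (h i)) /\ disjoint_supports h.

Lemma disjoint_supp_dist f g : density f -> density g ->
  m (supp f `&` supp g) = 0%E -> `|f - g| = 2.
Proof.
move=> [f0 f1] [g0 g1] /disjoint_suppE dfg.
have -> : 2 = `|f| + `|g| by rewrite f1 g1.
rewrite !norm_mass -massD; apply: mass_eq.
apply: (ae_mp f0); apply: (ae_mp g0); apply: (ae_mp (absLE f));
  apply: (ae_mp (absLE g)).
apply: (ae_mp (absLE (f - g))); apply: (ae_mp (L1_subE f g)).
apply: filterS2 dfg (L1_addE (absL f) (absL g)) => x dx -> -> -> -> -> a b.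
by case: dx => ->; rewrite ?subr0 ?sub0r ?normrN normr0 ?addr0 ?add0r.
Qed.

(** Disjoint densities are at distance 2, so a ball of radius 1 contains at
    most one of them. Hence the number of balls of radius 1 needed to cover
    [F] bounds [r]. *)
Lemma disjoint_family_bound (F : set V) : compact F ->
  (forall h, invariant_density P h -> F h) ->
  exists N, forall r (h : 'I_r -> V), disjoint_family h -> (r <= N)%N.
Proof.
rewrite compact_cover => cF FP.
have [|x Fx|D DF cov] := cF V F (fun c => ball c 1).
- by move=> c _; exact: ball_open.
- by exists x => //; exact: ballxx.
exists (size (finmap.enum_fset D)) => r h [hi dh].
have /choice[c hc] i : exists c, c \in finmap.enum_fset D /\ ball c 1 (h i).
  by have [c cD bc] := cov _ (FP _ (hi i)); exists c.
have cinj : injective c.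
  move=> i j ij; apply/eqP; apply: contraT => nij.
  have := disjoint_supp_dist (hi i).1 (hi j).1 (dh _ _ nij).
  have := (hc i).2; have := (hc j).2; rewrite ij -!ball_normE /= => a b e.
  have : `|h i - h j| < 1 + 1.
    rewrite -[h i](subrK (c j)) -addrA (le_lt_trans (ler_normD _ _))// ltrD//.
    by rewrite distrC.
  by rewrite e -mulr2n ltxx.
have := @uniq_leq_size _ (map c (enum 'I_r)) (finmap.enum_fset D).
rewrite size_map size_enum_ord; apply; first by rewrite map_inj_uniq// enum_uniq.
by move=> _ /mapP[i _ ->]; exact: (hc i).1.
Qed.

Lemma disjoint_family_extend r (h : 'I_r -> V) f : disjoint_family h ->
  invariant_density P f -> (forall i, m (supp f `&` supp (h i)) = 0%E) ->
  exists h' : 'I_r.+1 -> V, disjoint_family h'.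
Proof.
move=> [hi dh] fi fd.
exists (fun i => if unlift ord0 i is Some j then h j else f); split.
  by move=> i; case: unliftP.
move=> i j; case: (unliftP ord0 i) => [i' ->|->];
  case: (unliftP ord0 j) => [j' ->|->] //.
- by rewrite (inj_eq lift_inj); exact: dh.
- by move=> _; rewrite setIC.
Qed.

Lemma normalize_invariant f : (\forall x \ae m, 0 <= f x) -> P f = f -> mass f
  != 0 ->
  invariant_density P ((mass f)^-1 *: f).
Proof.
move=> f0 Pf nz; have mf0 := mass_ge0 f0; apply/invariant_densityE; split.
- apply: filterS2 f0 (L1_scaleE (mass f)^-1 f) => x ? ->.
  by rewrite mulr_ge0// invr_ge0.
- by rewrite massZ mulVf.
- by rewrite markovZ Pf.
Qed.

Lemma scale_disjoint a f g :
  (\forall x \ae m, f x = 0 \/ g x = 0) -> m (supp (a *: f) `&` supp g) = 0%E.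
Proof.
move=> H; apply/disjoint_suppE; apply: filterS2 H (L1_scaleE a f) => x + ->.
by case=> ->; [left; rewrite mulr0|right].
Qed.

(** The parts of [h i] on [A] and on its complement are both invariant. After
    normalization, the first replaces [h i] and the second is a new member of
    the family. *)
Lemma disjoint_family_split r (h : 'I_r -> V) (i : 'I_r) (A : set X) :
  disjoint_family h -> measurable A -> absorbing P A ->
  mass (resL A (h i)) != 0 -> mass (resL A (h i)) != 1 ->
  exists h' : 'I_r.+1 -> V, disjoint_family h'.
Proof.
move=> [hi dh] mA aA n0 n1.
have mAC := measurableC mA.
have [hi0 hi1 Phi] := (invariant_densityE P (h i)).1 (hi i).
pose f1 := resL A (h i); pose f2 := resL (~` A) (h i).
have f12 : h i = f1 + f2 by exact: resLC.
have Pf1 : P f1 = f1 by exact: invariant_resL.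
have f2E : f2 = h i - f1 by rewrite f12 addrC addKr.
have Pf2 : P f2 = f2 by rewrite f2E linearB Phi Pf1.
have f10 : \forall x \ae m, 0 <= f1 x by exact: mulL_ge0 (unit_valued_indic m
  mA) hi0.
have f20 : \forall x \ae m, 0 <= f2 x by exact: mulL_ge0 (unit_valued_indic m
  mAC) hi0.
have n2 : mass f2 != 0 by rewrite f2E massB hi1 subr_eq0 eq_sym.
pose g1 := (mass f1)^-1 *: f1.
have d1 j : i != j -> m (supp g1 `&` supp (h j)) = 0%E.
  move=> ij; apply: scale_disjoint; have /disjoint_suppE := dh i j ij.
  by apply: filterS2 (resLE (h i) mA) => x -> [->|->]; [left; rewrite mulr0|right].
have d2 j : i != j -> m (supp ((mass f2)^-1 *: f2) `&` supp (h j)) = 0%E.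
  move=> ij; apply: scale_disjoint; have /disjoint_suppE := dh i j ij.
  by apply: filterS2 (resLE (h i) mAC) => x -> [->|->]; [left; rewrite mulr0|right].
apply: (@disjoint_family_extend _ (fun j => if j == i then g1 else h j) ((mass
  f2)^-1 *: f2)).
- split=> [j|j k].
    case: ifP => _; last exact: hi.
    exact: (normalize_invariant f10 Pf1 n0).
  move=> jk; have [ji|ji] := eqVneq j i; have [ki|ki] := eqVneq k i.
  - by move: jk; rewrite ji ki eqxx.
  - by apply: d1; rewrite eq_sym.
  - by rewrite setIC; apply: d1; rewrite eq_sym.
  - exact: dh.
- exact: (normalize_invariant f20 Pf2 n2).
- move=> j; have [_|ji] := eqVneq j i; last by apply: d2; rewrite eq_sym.
  apply: scale_disjoint; apply: (ae_mp (L1_scaleE (mass f1)^-1 f1)).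
  apply: filterS2 (resLE (h i) mA) (resLE (h i) mAC) => x -> -> ->.
  rewrite !indicE in_setC; case: (x \in A); [left|right]; by rewrite !mul0r ?mulr0.
Qed.

Lemma cesaro_lim_ge0 f g : (\forall x \ae m, 0 <= f x) ->
  A_ n f @[n --> \oo] --> g -> \forall x \ae m, 0 <= g x.
Proof.
move=> f0 fg; suff : \forall x \ae m, (0 : V) x <= g x.
  by apply: filterS2 (L1_0E m) => x ->.
apply: ae_le_of_mass => A mA.
rewrite resL0// mass0.
have := mass_resL_continuous mA fg.
apply: (@closed_cvg _ _ _ _ _ [set y : R | 0 <= y]); first exact: closed_ge.
by apply: nearW => n; apply: mass_ge0; apply: mulL_ge0;
  [exact: unit_valued_indic|exact: cesaro_ge0].
Qed.

Lemma cesaro_lim_mass f g : A_ n f @[n --> \oo] --> g -> mass g = mass f.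
Proof.
move=> fg; apply/esym/eqP; rewrite -subr_eq0 -normr_le0; apply/ler_addgt0Pr => e e0.
rewrite add0r; move/cvgrPdist_le : fg => /(_ _ e0) [n _ /(_ n.+1 (leqnSn n)) H].
have [u eu] := @sub_cesaro_coboundary _ _ _ _ P n.+1 f isT.
have -> : mass f = mass (A_ n.+1 f).
  by apply/eqP; rewrite -subr_eq0 -massB eu massB (markov_mass hP) subrr.
by rewrite distrC -massB (le_trans (mass_le_norm _)).
Qed.

(** Let [a n] be the mass of [P^n 1] outside the support [S] of [h]. As [S] is
    absorbing, [a] is nonincreasing, so it lies below its averages, which tend
    to the mass of [g] outside [S], that is, to 0. Since [1 - a n] is the
    integral of the n-th adjoint iterate of the indicator of [S], which is
    nondecreasing in [n], these iterates tend to 1. *)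
Lemma supp_cover_maximal_support (h g : V) :
  (\forall x \ae m, 0 <= h x) -> P h = h ->
  A_ n (toL1 m (cst 1)) @[n --> \oo] --> g ->
  resL (~` supp h) g = 0 -> maximal_support P h.
Proof.
move=> h0 Ph; set one := toL1 m (cst 1) => Ag gS.
pose mS := measurable_supp h; have mSC := measurableC mS.
pose G n := iter n (adjoint P) (Linf_indic m mS).
have uG n : unit_valued m (G n) by exact: (adjoint_iter hP mS n).1.
have GE n : mass (toL1 m (G n)) = mass (resL (supp h) (iter n P one)).
  rewrite (adjoint_iter hP mS n).2; apply: mass_eq.
  apply: filterS3 (toL1_unit_valued (uG n)) (mulLE one (uG n))
    (toL1_unit_valued (unit_valued1 m)).
  by move=> x -> -> ->; rewrite mulr1.
have Gmono n : \forall x \ae m, G n x <= G n.+1 x.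
  elim: n => [|n IH]; last exact: (adjoint_le hP (uG n) (uG n.+1) IH).
  have := (absorbing_adjoint hP mS).1 (supp_absorbing hP h0 Ph).
  by apply: filterS2 (Linf_indicE m mS) => x ->.
apply: (unit_valued_mono_cvg1 uG Gmono).
pose a n := mass (resL (~` supp h) (iter n P one)).
have aE n : mass (toL1 m (G n)) = 1 - a n.
  have e : mass (resL (supp h) (iter n P one)) + a n = 1.
    by rewrite /a -massD -(resLC (iter n P one) mS) (iter_mass hP) mass_one.
  by rewrite GE; apply/eqP; rewrite eq_sym subr_eq e.
have adec : nonincreasing_seq a.
  apply/nonincreasing_seqP => n.
  have : mass (toL1 m (G n)) <= mass (toL1 m (G n.+1)).
    apply: mass_le; apply: filterS3 (Gmono n) (toL1_unit_valued (uG n))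
      (toL1_unit_valued (uG n.+1)).
    by move=> x le -> ->.
  by rewrite !aE lerD2l lerN2.
have one0 : \forall x \ae m, 0 <= one x.
  by apply: filterS (toL1_unit_valued (unit_valued1 m)) => x ->.
have a0 n : 0 <= a n.
  by apply: mass_ge0; apply: (mulL_ge0 (unit_valued_indic m mSC)); exact: iter_ge0.
have aA n : (0 < n)%N -> a n <= mass (resL (~` supp h) (A_ n one)).
  move=> n0; rewrite cesaroE resLZ// massZ mulrC ler_pdivlMr ?ltr0n//.
  have -> : mass (resL (~` supp h) (\sum_(i < n) iter i P one)) = \sum_(i < n) a i.
    rewrite -(big_mkord xpredT (fun i => iter i P one)) -(big_mkord xpredT a).
    elim: n {n0} => [|n IH]; last by rewrite !big_nat_recr//= resLD// massD IH.
    by rewrite !big_geq// resL0// mass0.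
  apply: (@le_trans _ _ (\sum_(i < n) a n)).
    by rewrite sumr_const card_ord mulr_natr.
  by apply: ler_sum => i _; apply: adec; exact: ltnW.
have a_cvg : a n @[n --> \oo] --> (0 : R).
  have := mass_resL_continuous mSC Ag; rewrite gS mass0 => cA.
  apply: (@squeeze_cvgr _ _ _ _ (cst 0) (fun n => mass (resL (~` supp h) (A_ n
    one)))) => //.
  - by exists 1%N => // n /= n0; rewrite a0 aA.
  - exact: cvg_cst.
rewrite (_ : (fun n => _) = (fun n => 1 - a n)); last by apply/funext.
have : 1 - a n @[n --> \oo] --> 1 - (0 : R) by apply: cvgB => //; exact: cvg_cst.
by rewrite subr0.
Qed.

(** Every invariant density is a cluster point of its own constant averages,
    so it belongs to [F], and families of disjoint invariant densities have
    bounded size. Take such a family of maximal size. Splitting one of its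
    members is impossible, whence ergodicity. The limit of the averages of 1
    is carried by the union of the supports, since otherwise its restriction
    to the complement would enlarge the family. *)
Lemma constrictive_ergodic_densities : mean_constrictive P ->
  finite_ergodic_densities P.
Proof.
move=> [F [cF hF]].
have invF h : invariant_density P h -> F h.
  move=> [dh Ph]; have [g Fg Hg] := constrictive_cluster cF (hF h dh).
  suff -> : h = g by [].
  apply/eqP; rewrite -subr_eq0 -normr_le0; apply/ler_addgt0Pr => e e0;
    rewrite add0r.
  by have [n [n0]] := Hg e 1%N e0; rewrite (cesaro_invariant n0 Ph).
pose one := toL1 m (cst 1).
have one0 : \forall x \ae m, 0 <= one x.
  by apply: filterS (toL1_unit_valued (unit_valued1 m)) => x ->.
have d1 : density one by split; [exact: one0|rewrite norm_ge0_mass// mass_one].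
have [g0 _ Hg0] := constrictive_cluster cF (hF one d1).
have [g [Pg Ag]] := mean_ergodic hP (cesaro_cluster_decomposable hP Hg0).
have g_ge0 := cesaro_lim_ge0 one0 Ag.
have g1 : mass g = 1 by rewrite (cesaro_lim_mass Ag) mass_one.
pose fam r := `[< exists h : 'I_r -> V, disjoint_family h >].
have fam1 : fam 1%N.
  apply/asboolP; exists (fun=> g); split; last by move=> i j; rewrite !ord1 eqxx.
  by move=> _; apply/invariant_densityE.
have [N HN] := disjoint_family_bound cF invF.
have ub r : fam r -> (r <= N)%N by move/asboolP => [h /HN].
have exfam : exists r, fam r by exists 1%N.
case: (ex_maxnP exfam ub) => r /asboolP[h [hi dh]] rmax.
(* Maximality of the family, used once for ergodicity and once for the
   support. *)
have nomore : ~ exists h' : 'I_r.+1 -> V, disjoint_family h'.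
  by move/asboolP/rmax; rewrite ltnn.
have r0 : (0 < r)%N by exact: rmax.
exists r, h; split => //.
- move=> i; apply/(ergodic_densityE hP); split; first exact: hi.
  move=> A mA aA; have [|n0] := eqVneq (mass (resL A (h i))) 0; first by left.
  have [|n1] := eqVneq (mass (resL A (h i))) 1; first by right.
  by case: nomore; exact: (disjoint_family_split (conj hi dh) mA aA n0 n1).
set hb : V := _ *: _.
have hI i := (invariant_densityE P (h i)).1 (hi i).
have hall : \forall x \ae m, forall i, 0 <= h i x.
  by apply: filter_forall => i; have [] := hI i.
have hb0 : \forall x \ae m, 0 <= hb x.
  by apply: filterS2 hall (averageE h) => x H ->;
    rewrite mulr_ge0 ?invr_ge0// sumr_ge0.
have Phb : P hb = hb.
  rewrite /hb markovZ linear_sum; congr (_ *: _); apply: eq_bigr => i _.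
  by have [] := hI i.
have mS := measurable_supp hb; have mSC := measurableC mS.
apply: (supp_cover_maximal_support hb0 Phb Ag).
set f := resL _ g.
have f0 : \forall x \ae m, 0 <= f x by exact: mulL_ge0 (unit_valued_indic m
  mSC) g_ge0.
have Pf : P f = f.
  have -> : f = g - resL (supp hb) g by rewrite {1}(resLC g mS) addrC addKr.
  by rewrite (linearB P) Pg (invariant_resL hP mS (supp_absorbing hP hb0 Phb) Pg).
have [mf|nf] := eqVneq (mass f) 0; first exact: mass_eq0.
case: nomore; apply: (disjoint_family_extend (conj hi dh) (normalize_invariant
  f0 Pf nf)).
move=> i; apply: scale_disjoint.
apply: (ae_mp hall); apply: filterS2 (resL_out g mSC) (averageE h) => x H1 H2 H3.
have [xS|/negP] := boolP (x \in supp hb).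
  by left; apply: H1; rewrite inE in xS => /(_ xS).
rewrite inE /supp /= => /negP; rewrite negbK H2 mulf_eq0 invr_eq0 pnatr_eq0.
rewrite -[r == 0]negbK -lt0n r0 /= psumr_eq0// => /allP /(_ i).
by rewrite mem_index_enum => /(_ isT) /eqP; right.
Qed.
End MeanConstrictive.

Theorem theorem4 (d : measure_display) (X : measurableType d) (R : realType)
  (m : probability X R) (P : {linear L1 m -> L1 m}) (hP : markov_operator P) :
  [<-> mean_constrictive P;
       finite_ergodic_densities P;
       asymptotically_periodic_in_mean P].
Proof.
tfae.
- exact: constrictive_ergodic_densities.
- exact: ergodic_densities_periodic.
- exact: periodic_constrictive.
Qed.
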